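(* Let $G=1+\mathfrak{g}$ be a pattern subgroup of $UT_n(\mathbb{F}_q)$, let $n=k+m$ with $k,m$ nonnegative integers, and let $G=N\rtimes H$ with $H=H_k\times H_m$ as in the context. Let $\mathcal{L}$ be the lattice of subgroups of $H$ of the form $K_k\times K_m$ with $K_k$ a right ideal subgroup of $H_k$ and $K_m$ a left ideal subgroup of $H_m$, where $K_k\times K_m$ is equipped with the direct product of the right ideal supercharacter theory of $K_k$ and the left ideal supercharacter theory of $K_m$. For each $\psi\in\mathrm{Irr}(N)$, let $H_\psi=I_{\mathcal{L}}(\psi)$ be the maximal element of $\mathcal{L}$ contained in the stabilizer $I_H(\psi)$. Then the supercharacter theory of $G$ obtained from $\mathcal{L}$ and these choices of $H_\psi$ by the little groups construction is the same as the algebra group supercharacter theory of $G$.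
   Context: **Supercharacter theories.** A supercharacter theory of a finite group $G$ is a pair $(\mathcal{K},\mathcal{X})$, where $\mathcal{K}$ is a partition of $G$ into unions of conjugacy classes and $\mathcal{X}$ is a set of characters of $G$, such that $|\mathcal{X}|=|\mathcal{K}|$, each $\chi\in\mathcal{X}$ is constant on the blocks of $\mathcal{K}$ (the superclasses), and each irreducible character of $G$ is a constituent of exactly one element of $\mathcal{X}$ (the supercharacters). Two supercharacter theories are the same if they have the same superclasses; equivalently, the same supercharacters up to positive scalar multiples. The direct product of supercharacter theories $(\mathcal{K},\mathcal{X})$ of $M$ and $(\mathcal{K}',\mathcal{Y})$ of $M'$ is the supercharacter theory of $M\times M'$ with superclasses $A\times B$ ($A\in\mathcal{K}$, $B\in\mathcal{K}'$) and supercharacters $\chi\times\psi$ ($\chi\in\mathcal{X}$, $\psi\in\mathcal{Y}$). **Algebra groups.** For a (finite-dimensional) nilpotent associative algebra $\mathfrak{a}$ over $\mathbb{F}_q$, the algebra group is $A=1+\mathfrak{a}=\{1+x\mid x\in\mathfrak{a}\}$ with $(1+x)(1+y)=1+(x+y+xy)$; write $f(1+x)=x$. $UT_n(\mathbb{F}_q)$ is the group of unipotent upper-triangular $n\times n$ matrices. For a partial order $\mathcal{P}$ on $\{1,\dots,n\}$ contained in the usual linear order, the pattern group is $\{g\in UT_n(\mathbb{F}_q)\mid g_{ij}\ne0\Rightarrow i\preceq_{\mathcal{P}}j\}$; it is an algebra group. Fix a nontrivial homomorphism $\theta:\mathbb{F}_q^+\to\mathbb{C}^\times$. Whenever $A_1$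 acts on the left and $A_2$ on the right of a space $V$ by multiplication, they act on the dual $V^*$ by $(g\lambda h)(x)=\lambda(g^{-1}xh^{-1})$. *Algebra group supercharacter theory of $A$*: superclasses $\{h\in A\mid f(h)\in A f(g)A\}$ for $g\in A$; supercharacters $\chi_\lambda=\frac{|A\lambda|}{|A\lambda A|}\sum_{\mu\in A\lambda A}\theta\circ\mu\circ f$ for $\lambda\in\mathfrak{a}^*$. A subgroup $B=1+\mathfrak{b}$ of $A$ is a left (right) ideal subgroup if $\mathfrak{b}$ is a left (right) ideal of $\mathfrak{a}$. *Left ideal supercharacter theory of $B$* (for $B$ a left ideal subgroup): superclasses $\{h\in B\mid f(h)\in Af(g)B\}$, $g\in B$; supercharacters $\frac{|A\lambda|}{|A\lambda B|}\sum_{\mu\in A\lambda B}\theta\circ\mu\circ f$, $\lambda\in\mathfrak{b}^*$. *Right ideal supercharacter theory of $B$* (for $B$ a right ideal subgroup): superclasses $\{h\in B\mid f(h)\in Bf(g)A\}$, $g\in B$; supercharacters $\frac{|\lambda A|}{|B\lambda A|}\sum_{\mu\in B\lambda A}\theta\circ\mu\circ f$, $\lambda\in\mathfrak{b}^*$. Here the ambient algebra group $A$ is $H_k$ for right ideal subgroups of $H_k$, and $H_m$ for left ideal subgroups of $H_m$. **Decomposition of $G$.** $H_k=\{g\in G\mid g_{ij}=0\text{ if } j>k \text{ and } j>i\}$, $H_m=\{g\in G\mid g_{ij}=0\text{ if } i\le k\text{ and } i<j\}$, $N=\{g\in G\mid g_{ij}=0 \text{ if } i<j \text{ and } (j\le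 k\text{ or } i>k)\}$. Then $N$ is abelian and normal, and $G=N\rtimes H$ with $H=H_k\times H_m$. **Little groups construction.** For $\psi\in\mathrm{Irr}(N)$, $I_H(\psi)$ is the stabilizer of $\psi$ in $H$ under conjugation. For a subgroup $K\subseteq I_H(\psi)$ and a character $\chi$ of $K$, let $\psi\rtimes\chi=\mathrm{Ind}_{NK}^G(\vartheta)$, where $\vartheta(nk)=\psi(n)\chi(k)$ ($n\in N,k\in K$). Given the subgroups $H_\psi$ with their supercharacter theories, let $S_\psi=\{\mathrm{Ind}_{H_\psi}^{I_H(\psi)}(\chi)\mid\chi\text{ a supercharacter of }H_\psi\}$ and let $S$ be a set of representatives of the $G$-orbits on $\mathrm{Irr}(N)$. The supercharacter theory obtained by the little groups construction is the one whose set of supercharacters is $\{\psi\rtimes\chi\mid\psi\in S,\ \chi\in S_\psi\}$. *)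

(* Defs.v *)
From HB Require Import structures.
From mathcomp Require Import all_boot all_order all_fingroup all_algebra.
From mathcomp Require Import all_solvable all_field all_character.

Set Implicit Arguments.
Unset Strict Implicit.
Unset Printing Implicit Defensive.

Import Order.TTheory GRing.Theory Num.Theory GroupScope.
Local Open Scope ring_scope.

(* Matrix indices are 0-based: the index "i" of {1, ..., n} is the ordinal
   i - 1, so that 1-based "j <= k" reads (j < k)%N below. *)

Definition unitri (F : finFieldType) (n : nat) (A : 'M[F]_n) : bool :=
  [forall i : 'I_n, forall j : 'I_n,
     ((i == j) ==> (A i j == 1)) && ((j < i)%N ==> (A i j == 0))].

(* A dedicated finite group rather than a subset of {'GL_n[F]}, which is only
   meaningful for positive n. *)
Record UT (F : finFieldType) (n : nat) : predArgType :=
  MkUT { utval :> 'M[F]_n; _ : unitri utval }.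

HB.instance Definition _ F n := [isSub for @utval F n].
HB.instance Definition _ F n := [Finite of UT F n by <:].

Section UTGroup.
Variables (F : finFieldType) (n : nat).
Implicit Types A B : 'M[F]_n.

Lemma unitriP A :
  reflect ((forall i, A i i = 1) /\ (forall i j : 'I_n, (j < i)%N -> A i j = 0))
          (unitri A).
Proof.
apply: (iffP forallP) => [uA | [A1 A0] i].
  split=> [i | i j ltji].
    by have /forallP/(_ i)/andP[/implyP/(_ (eqxx i))/eqP] := uA i.
  by have /forallP/(_ j)/andP[_ /implyP/(_ ltji)/eqP] := uA i.
apply/forallP=> j; apply/andP; split; apply/implyP.
  by move/eqP=> <-; rewrite A1.
by move=> ltji; rewrite A0.
Qed.

Lemma unitri1 : unitri (1%:M : 'M[F]_n).
Proof.
apply/unitriP; split=> [i | i j ltji]; rewrite mxE ?eqxx //.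
by rewrite -val_eqE /= gtn_eqF.
Qed.

Lemma unitri_mul A B : unitri A -> unitri B -> unitri (A *m B).
Proof.
move=> /unitriP[A1 A0] /unitriP[B1 B0]; apply/unitriP.
split=> [i | i j ltji]; rewrite mxE.
  rewrite (bigD1 i) //= A1 B1 mulr1 big1 ?addr0 // => l neqli.
  have [lt_li | le_il] := ltnP l i; first by rewrite A0 ?mul0r.
  by rewrite B0 ?mulr0 // ltn_neqAle le_il andbT eq_sym.
rewrite big1 // => l _.
have [lt_li | le_il] := ltnP l i; first by rewrite A0 ?mul0r.
by rewrite B0 ?mulr0 // (leq_trans ltji).
Qed.

Lemma unitri_unit A : unitri A -> A \in unitmx.
Proof.
move=> /unitriP[A1 A0]; rewrite unitmxE -det_tr det_trig.
  by rewrite big1 ?unitr1 // => i _; rewrite mxE.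
by apply/is_trig_mxP=> i j ltij; rewrite mxE A0.
Qed.

Definition ut_one : UT F n := MkUT unitri1.
Definition ut_mul (x y : UT F n) : UT F n :=
  MkUT (unitri_mul (valP x) (valP y)).

Lemma ut_mul_inj x : injective (ut_mul x).
Proof.
move=> y z /(congr1 val) /= /(congr1 (mulmx (invmx x))).
by rewrite !mulKmx ?unitri_unit ?(valP x) // => /val_inj.
Qed.

Lemma unitri_inv A : unitri A -> unitri (invmx A).
Proof.
move=> uA; have injA := @ut_mul_inj (MkUT uA).
have /(congr1 val) /= AB1 := f_invF injA ut_one.
rewrite -[invmx A]mulmx1 -AB1 mulKmx ?unitri_unit //.
exact: valP.
Qed.

Definition ut_inv (x : UT F n) : UT F n := MkUT (unitri_inv (valP x)).

Fact ut_mulA : associative ut_mul.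
Proof. by move=> x y z; apply: val_inj; rewrite /= mulmxA. Qed.
Fact ut_mul1 : left_id ut_one ut_mul.
Proof. by move=> x; apply: val_inj; rewrite /= mul1mx. Qed.
Fact ut_mulV : left_inverse ut_one ut_inv ut_mul.
Proof.
by move=> x; apply: val_inj; rewrite /= mulVmx // unitri_unit // (valP x).
Qed.

HB.instance Definition _ :=
  Finite_isGroup.Build (UT F n) ut_mulA ut_mul1 ut_mulV.

Lemma utM (x y : UT F n) : utval (x * y)%g = utval x *m utval y.
Proof. by []. Qed.

Lemma ut1 : utval (1%g : UT F n) = 1%:M.
Proof. by []. Qed.

Lemma utV (x : UT F n) : utval x^-1%g = invmx (utval x).
Proof. by []. Qed.

End UTGroup.

Record pat_order (n : nat) := PatOrder {
  pat_rel :> rel 'I_n;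
  pat_refl : reflexive pat_rel;
  pat_anti : antisymmetric pat_rel;
  pat_trans : transitive pat_rel;
  pat_leq : forall i j : 'I_n, pat_rel i j -> (i <= j)%N
}.

Section PatternGroups.
Variables (F : finFieldType) (n : nat) (P : pat_order n) (k : nat).
Implicit Types g h : UT F n.

Definition pattern : {set UT F n} :=
  [set g : UT F n | [forall i, forall j, (g i j != 0) ==> P i j]].

Definition patN : {set UT F n} :=
  [set g in pattern | [forall i : 'I_n, forall j : 'I_n,
     ((i < j)%N && ((j < k)%N || (k <= i)%N)) ==> (g i j == 0)]].

Definition patHk : {set UT F n} :=
  [set g in pattern | [forall i : 'I_n, forall j : 'I_n,
     ((k <= j)%N && (i < j)%N) ==> (g i j == 0)]].

Definition patHm : {set UT F n} :=
  [set g in pattern | [forall i : 'I_n, forall j : 'I_n,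
     ((i < k)%N && (i < j)%N) ==> (g i j == 0)]].

Lemma pattern_group_set : group_set pattern.
Proof.
apply/group_setP; split=> [|g h].
  rewrite inE; apply/'forall_forallP=> i j.
  rewrite ut1 mxE; case: (i =P j) => [-> | _]; first by rewrite pat_refl implybT.
  by rewrite mulr0n eqxx.
rewrite !inE => /'forall_forallP gP /'forall_forallP hP.
apply/'forall_forallP=> i j; apply/implyP; apply: contraR => nPij; apply/eqP.
rewrite utM mxE big1 // => l _; apply/eqP; rewrite mulf_eq0.
apply: contraR nPij; rewrite negb_or => /andP[gil hlj].
exact: pat_trans (implyP (gP _ _) gil) (implyP (hP _ _) hlj).
Qed.
Canonical pattern_group := Group pattern_group_set.

(* [Z] is a set of strictly upper triangular positions such that a position of
   [Z] is never split into two positions outside [Z]. *)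
Let zero_group_set (Z : rel 'I_n) :
  (forall i j, Z i j -> (i < j)%N) ->
  (forall i l j : 'I_n, (i < l)%N -> (l < j)%N -> Z i j -> Z i l || Z l j) ->
  group_set [set g in pattern |
               [forall i, forall j, Z i j ==> (g i j == 0)]].
Proof.
move=> Zlt Zsplit; apply/group_setP; split=> [|g h].
  rewrite inE group1; apply/'forall_forallP=> i j; apply/implyP=> /Zlt ltij.
  by rewrite ut1 mxE -val_eqE /= ltn_eqF.
rewrite !(inE, in_setI) => /andP[gP /'forall_forallP g0].
case/andP=> hP /'forall_forallP h0; apply/andP; split.
  by have := groupM (_ : g \in pattern_group) (_ : h \in pattern_group);
     rewrite !inE => ->.
apply/'forall_forallP=> i j; apply/implyP=> Zij.
have [_ gL] := unitriP _ (valP g); have [_ hL] := unitriP _ (valP h).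
rewrite utM mxE big1 // => l _; apply/eqP; rewrite mulf_eq0.
have [lt_li | lt_il | /val_inj eq_il] := ltngtP l i.
- by rewrite gL ?eqxx.
- have [lt_lj | lt_jl | /val_inj eq_lj] := ltngtP l j.
  + have [Zil | Zlj] := orP (Zsplit _ _ _ lt_il lt_lj Zij).
      by rewrite (implyP (g0 i l) Zil).
    by rewrite (implyP (h0 l j) Zlj) orbT.
  + by rewrite hL ?eqxx ?orbT.
  + by rewrite eq_lj (implyP (g0 i j) Zij).
- by rewrite eq_il (implyP (h0 i j) Zij) orbT.
Qed.

Lemma patN_group_set : group_set patN.
Proof.
apply: (zero_group_set
  (Z := fun i j : 'I_n => (i < j)%N && ((j < k)%N || (k <= i)%N))).
  by move=> i j /andP[].
move=> i l j lt_il lt_lj /andP[_ /orP[lt_jk | le_ki]].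
  by rewrite lt_il (ltn_trans lt_lj).
by rewrite lt_il le_ki orbT.
Qed.
Canonical patN_group := Group patN_group_set.

Lemma patHk_group_set : group_set patHk.
Proof.
apply: (zero_group_set (Z := fun i j : 'I_n => (k <= j)%N && (i < j)%N)).
  by move=> i j /andP[].
by move=> i l j lt_il lt_lj /andP[-> _]; rewrite lt_lj orbT.
Qed.
Canonical patHk_group := Group patHk_group_set.

Lemma patHm_group_set : group_set patHm.
Proof.
apply: (zero_group_set (Z := fun i j : 'I_n => (i < k)%N && (i < j)%N)).
  by move=> i j /andP[].
by move=> i l j lt_il lt_lj /andP[-> _]; rewrite lt_il.
Qed.
Canonical patHm_group := Group patHm_group_set.

Definition patH : {set UT F n} := patHk <*> patHm.
Canonical patH_group := [group of patH].

End PatternGroups.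

(* The raw data (superclasses and supercharacters) for a candidate
   supercharacter theory; the axioms are [is_sct]. Complex characters take
   their values in [algC]. *)
Record sct_data (gT : finGroupType) (G : {set gT}) := SctData {
  superclasses : {set {set gT}};
  supercharacter : 'CF(G) -> Prop
}.

Definition is_sct (gT : finGroupType) (G : {group gT}) (T : sct_data G) : Prop :=
  [/\ partition (superclasses T) G,
      (forall A x, A \in superclasses T -> x \in A -> x ^: G \subset A),
      (forall chi, supercharacter T chi ->
         [/\ chi \is a character, chi != 0 &
             forall A x y, A \in superclasses T -> x \in A -> y \in A ->
               chi x = chi y]),
      (exists X : seq 'CF(G),
         [/\ uniq X, (forall chi, chi \in X <-> supercharacter T chi) &
             size X = #|superclasses T|])
    & forall i : Iirr G,
        exists! chi, supercharacter T chi /\ i \in irr_constt chi].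

Definition same_sct (gT : finGroupType) (G : {group gT}) (T1 T2 : sct_data G)
    : Prop :=
  [/\ is_sct T1, is_sct T2 & superclasses T1 = superclasses T2].

(* The direct product, for commuting subgroups [M], [M'] with trivial
   intersection, inside their internal direct product. *)
Definition dprod_sct (gT : finGroupType) (M M' : {group gT})
    (T : sct_data M) (T' : sct_data M') : sct_data (M <*> M') :=
  SctData
    [set (A * B)%g | A in superclasses T, B in superclasses T']
    (fun xi : 'CF(M <*> M') =>
       exists chi : 'CF(M), exists psi : 'CF(M'),
         [/\ supercharacter T chi, supercharacter T' psi &
             {in M & M', forall x y, xi (x * y)%g = chi x * psi y}]).

Section AlgebraGroups.
Variables (F : finFieldType) (n : nat).
Local Notation gT := (UT F n).
Implicit Types (A B : {set gT}) (L R : {group gT}).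

Definition lg (g : gT) : 'M[F]_n := utval g - 1%:M.

Definition alg_of A : {set 'M[F]_n} := lg @: A.

Definition is_subspace (b : {set 'M[F]_n}) : Prop :=
  forall (c : F) x y, x \in b -> y \in b -> c *: x + y \in b.

Definition left_ideal_subgroup B A : Prop :=
  [/\ B \subset A, is_subspace (alg_of B) &
      forall a x, a \in alg_of A -> x \in alg_of B -> a *m x \in alg_of B].

Definition right_ideal_subgroup B A : Prop :=
  [/\ B \subset A, is_subspace (alg_of B) &
      forall a x, a \in alg_of A -> x \in alg_of B -> x *m a \in alg_of B].

(* A linear form on the subspace [b] is encoded by its extension by 0 outside
   [b] (this extension is usually not linear). When b is stable under
   x |-> g x h, [dual_act] below preserves [dual b] and is the action on it. *)
Definition dual (b : {set 'M[F]_n}) : {set {ffun 'M[F]_n -> F}} :=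
  [set lam : {ffun 'M[F]_n -> F} |
     [forall x, (x \notin b) ==> (lam x == 0)] &&
     [forall c : F, forall x in b, forall y in b,
        lam (c *: x + y) == c * lam x + lam y]].

Definition dual_act (g : gT) (lam : {ffun 'M[F]_n -> F}) (h : gT)
    : {ffun 'M[F]_n -> F} :=
  [ffun x => lam (utval g^-1%g *m x *m utval h^-1%g)].

Definition dual_orbit L (lam : {ffun 'M[F]_n -> F}) R :
    {set {ffun 'M[F]_n -> F}} :=
  [set dual_act g lam h | g in L, h in R].

Definition two_sided_class L B R (g : gT) : {set gT} :=
  [set h in B | [exists a in L, exists b in R,
                   lg h == utval a *m lg g *m utval b]].

Variable theta : F -> algC.

Definition orbit_sum (O : {set {ffun 'M[F]_n -> F}}) (g : gT) : algC :=
  \sum_(mu in O) theta (mu (lg g)).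

Definition left_ideal_sct (A B : {group gT}) : sct_data B :=
  SctData
    [set two_sided_class A B B g | g in B]
    (fun chi : 'CF(B) => exists2 lam, lam \in dual (alg_of B) &
       {in B, forall g, chi g =
          #|dual_orbit A lam 1|%:R / #|dual_orbit A lam B|%:R
            * orbit_sum (dual_orbit A lam B) g}).

Definition right_ideal_sct (A B : {group gT}) : sct_data B :=
  SctData
    [set two_sided_class B B A g | g in B]
    (fun chi : 'CF(B) => exists2 lam, lam \in dual (alg_of B) &
       {in B, forall g, chi g =
          #|dual_orbit 1 lam A|%:R / #|dual_orbit B lam A|%:R
            * orbit_sum (dual_orbit B lam A) g}).

Definition algebra_group_sct (A : {group gT}) : sct_data A :=
  SctData
    [set two_sided_class A A A g | g in A]
    (fun chi : 'CF(A) => exists2 lam, lam \in dual (alg_of A) &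
       {in A, forall g, chi g =
          #|dual_orbit A lam 1|%:R / #|dual_orbit A lam A|%:R
            * orbit_sum (dual_orbit A lam A) g}).

End AlgebraGroups.

Definition orbit_reps (gT : finGroupType) (G N : {group gT})
    (reps : {set Iirr N}) : Prop :=
  forall i : Iirr N,
    exists! j : Iirr N, j \in reps /\ 'chi_j \in ('chi_i ^: G)%CF.

(* phi is the character psi \rtimes chi of G, for chi a character of a
   subgroup K of a complement of N that stabilizes psi. *)
Definition is_rtimes (gT : finGroupType) (G N K : {group gT})
    (psi : 'CF(N)) (chi : 'CF(K)) (phi : 'CF(G)) : Prop :=
  exists2 vtheta : 'CF(N <*> K),
    {in N & K, forall x y, vtheta (x * y)%g = psi x * chi y} &
    phi = 'Ind[G] vtheta.

(* The supercharacters given by the little groups construction for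
   G = N >< H, from representatives and subgroups [Hpsi i] of the stabilizer
   in H of 'chi_i, each equipped with [T i]. *)
Definition little_groups_character (gT : finGroupType) (G N H : {group gT})
    (reps : {set Iirr N}) (Hpsi : Iirr N -> {group gT})
    (T : forall i, sct_data (Hpsi i)) (phi : 'CF(G)) : Prop :=
  exists2 i : Iirr N, i \in reps &
    exists2 chi : 'CF(Hpsi i), supercharacter (T i) chi &
      is_rtimes 'chi_i ('Ind['I_H['chi_i], Hpsi i] chi) phi.

Section Lattice.
Variables (F : finFieldType) (n : nat) (P : pat_order n) (k : nat).
Local Notation gT := (UT F n).

(* An element of the lattice is the subgroup Kk \x Km (= Kk <*> Km) of H,
   handled through its two factors. *)
Definition in_lattice (Kk Km : {group gT}) : Prop :=
  right_ideal_subgroup Kk (patHk F P k) /\ left_ideal_subgroup Km (patHm F P k).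

Definition is_lattice_inertia (psi : 'CF(patN F P k)) (Kk Km : {group gT})
    : Prop :=
  [/\ in_lattice Kk Km, Kk <*> Km \subset 'I_(patH F P k)[psi] &
      forall Kk' Km' : {group gT}, in_lattice Kk' Km' ->
        Kk' <*> Km' \subset 'I_(patH F P k)[psi] ->
        Kk <*> Km \subset Kk' <*> Km' -> Kk' <*> Km' = Kk <*> Km].

End Lattice.

(* Main.v *)
(* Every supercharacter in sight has the form
     x |-> S^-1 * \sum_(g in L, h in R) theta (lam (g * (x - 1) * h)),
   with S = \sum_(g in L, h in R) theta (lam ((g - 1) * (h - 1))); this makes
   the little groups construction computable, and it turns out to produce
   exactly the supercharacters chi_lam, not just multiples of them.  Indeed, if
   lam restricts on n to the form of psi, then K_k and K_m are the left and
   right stabilizers of lam on n.  For P = H_m N K_k and Q = K_m N H_k, summing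
   theta (lam (p (g - 1) q)) over P x Q is, up to a constant factor, the
   extension by zero of psi # (chi_k x chi_m) from N (K_k x K_m) to G, because
   the sums over the factors N of P and Q detect membership of the components
   of g in K_k and K_m.  Inducing to G averages over conjugation by y in G, and
   (p, q, y) |-> (p y^-1, y q) covers G x G uniformly, which gives chi_lam.

   That these chi_lam form a supercharacter theory comes from orthogonality of
   the functions theta \o lam, the monomial representation on G lam, and the
   equality of the numbers of G x G-orbits on g and on its dual. *)
Require Import Defs.
From HB Require Import structures.
From mathcomp Require Import all_boot all_order all_fingroup all_algebra.
From mathcomp Require Import all_solvable all_field all_character.
From mathcomp Require Import ring.

Set Implicit Arguments.
Unset Strict Implicit.
Unset Printing Implicit Defensive.

Import Order.TTheory GRing.Theory Num.Theory GroupScope.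
Local Open Scope ring_scope.

(* Keeps [/=] from unfolding the group operations of [UT] to matrix ones. *)
#[local] Arguments utval : simpl never.

(** The definitions normalize by orbit sizes on the duals of three different algebras, those of [G],
    [Kk] and [Km], and comparing these sizes directly is the obstacle. The constant S avoids it.
    Over an ideal its inner sum is a full character sum on a vector space, equal to the order of
    that space or to 0 according to whether the group element fixes [lam]; so S is a stabilizer
    order times a group order. Being a sum of the same shape as the values, S for [G] factors as
    [#|N|%:R ^+ 2] times the constants for [Kk] and [Km]. All factorizations rest on block
    multiplication: cut at [k], the elements of g are upper triangular 2 x 2 block matrices with
    diagonal blocks in h_k and h_m and corner in n. From little groups to [G], the given forms live
    on the algebras of [Kk], [N] and [Km], in complementary blocks; they glue to one form, and any
    extension of it to g serves as [lam]. Since the two sets of supercharacters coincide literally,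
    the axioms have to be checked only for the algebra group theory. *)

Lemma cfun_exists (gT : finGroupType) (G : {group gT}) (f : gT -> algC) :
  {in G &, forall x y, f (x ^ y)%g = f x} ->
  exists chi : 'CF(G), {in G, chi =1 f}.
Proof.
move=> fJ; have clf : is_class_fun <<G>> [ffun x => f x *+ (x \in G)].
  rewrite genGid; apply: intro_class_fun => [x y Gx Gy | x /negbTE-> //].
  by rewrite groupJr // fJ.
by exists (Cfun 0 clf) => x Gx; rewrite cfunE Gx.
Qed.

(** The matrices with entry [c x g] at position [(x, to x g)] form a monomial representation: the
    conditions on [c] are the cocycle identities that make them multiply correctly. Only the fixed
    points of [g] contribute to the trace. *)
Lemma char_monomial (gT : finGroupType) (G : {group gT}) (T : finType)
    (Om : {set T}) (to : T -> gT -> T) (c : T -> gT -> algC) (chi : 'CF(G)) :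
  {in Om & G, forall x g, to x g \in Om} ->
  {in Om, forall x, to x 1%g = x} ->
  {in Om & G &, forall x g h, to x (g * h)%g = to (to x g) h} ->
  {in Om, forall x, c x 1%g = 1} ->
  {in Om & G &, forall x g h, c x (g * h)%g = c x g * c (to x g) h} ->
  {in G, forall g, chi g = \sum_(x in Om | to x g == x) c x g} ->
  chi \is a character.
Proof.
move=> toOm to1 toM c1 cM chiE.
pose rho g : 'M[algC]_#|Om| :=
  \matrix_(i, j) (c (enum_val i) g *+ (to (enum_val i) g == enum_val j)).
have rhoP : mx_repr G rho.
  split=> [|g h Gg Gh]; apply/matrixP=> i j.
    by rewrite !mxE to1 ?c1 ?enum_valP // (inj_eq enum_val_inj).
  have Om_i := enum_valP i.
  rewrite !mxE (bigD1 (enum_rank_in Om_i (to (enum_val i) g))) //=.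
  rewrite !mxE enum_rankK_in ?toOm // eqxx mulr1n toM // cM // mulrnAr.
  rewrite big1 ?addr0 // => l nl; rewrite mxE; case: eqP => [El|]; last first.
    by rewrite mulr0n mul0r.
  by rewrite El enum_valK_in eqxx in nl.
suffices ->: chi = cfRepr (MxRepresentation rhoP) by apply: cfRepr_char.
apply/cfun_inP=> g Gg; rewrite chiE // cfunE Gg mulr1n.
rewrite /mxtrace big_mkcondr /= big_enum_val /=.
by apply: eq_bigr => i _; rewrite mxE mulrb.
Qed.

Lemma sum_mulg (gT : finGroupType) (A B G : {group gT}) (f : gT -> algC) :
  (A * B)%g = G ->
  \sum_(a in A) \sum_(b in B) f (a * b)%g
    = #|A :&: B|%:R * \sum_(g in G) f g.
Proof.
move=> defG.
have sum_b a : a \in A ->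
  \sum_(b in B) f (a * b)%g = \sum_(g in G | (a^-1 * g)%g \in B) f g.
  move=> Aa; rewrite (reindex_inj (mulgI (a^-1)%g)) /=.
  apply: eq_big => [g | g _]; last by rewrite mulKVg.
  rewrite andb_idl // -defG => Bg; apply/mulsgP.
  by exists a (a^-1 * g)%g; rewrite ?mulKVg.
rewrite (eq_bigr _ sum_b) (exchange_big_dep (mem G)) /=; last first.
  by move=> a g _ /andP[].
rewrite mulr_sumr; apply: eq_bigr => g Gg.
have /mulsgP[a0 b0 Aa0 Bb0 def_g]: g \in (A * B)%g by rewrite defG.
rewrite sumr_const mulr_natl; congr (_ *+ _).
(* The first factors [a] of the factorizations of [g] form the left coset of [A :&: B] through
   [a0]. *)
rewrite -(card_lcoset _ a0); apply: eq_card => a.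
rewrite mem_lcoset !inE Gg /= groupMl ?groupV //; congr (_ && _).
by rewrite def_g mulgA groupMr // -groupV invMg invgK.
Qed.

Lemma sum_orbit (aT : finGroupType) (T : finType) (to : {action aT &-> T})
    (G : {group aT}) (x : T) (f : T -> algC) :
  #|orbit to G x|%:R * \sum_(a in G) f (to x a)
    = #|G|%:R * \sum_(y in orbit to G x) f y.
Proof.
rewrite (partition_big (to x) (mem (orbit to G x))) /=; last first.
  by move=> a Ga; apply: mem_orbit.
rewrite !mulr_sumr; apply: eq_bigr => _ /orbitP[a Ga <-].
rewrite (eq_bigr (fun=> f (to x a))) => [|b /andP[_ /eqP-> //]].
rewrite sumr_const mulr_natl -mulrnA mulr_natl; congr (_ *+ _).
rewrite mulnC -(card_orbit_stab to G x); congr (_ * _)%N.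
rewrite -(card_rcoset _ a) -amove_act ?subsetT //.
by apply: eq_card => b; rewrite !inE.
Qed.

(** * Fourier analysis on spaces of matrices *)

Section Fourier.
Variables (F : finFieldType) (theta : F -> algC).
Hypothesis theta_neq0 : forall x : F, theta x != 0.
Hypothesis thetaD : forall x y : F, theta (x + y) = theta x * theta y.
Hypothesis theta_neq1 : exists x : F, theta x != 1.

Lemma theta0 : theta 0 = 1.
Proof.
by apply: (mulfI (theta_neq0 0)); rewrite -thetaD addr0 mulr1.
Qed.

Lemma thetaN x : theta (- x) = (theta x)^-1.
Proof.
by apply: (mulfI (theta_neq0 x)); rewrite -thetaD subrr theta0 divff.
Qed.

Lemma conj_theta x : (theta x)^* = theta (- x).
Proof.
(* In characteristic p, [theta x ^+ p = theta (x *+ p) = 1]; hence [theta x] has norm 1 and its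
   conjugate is its inverse. *)
have theta_nat d : theta (x *+ d) = theta x ^+ d.
  by elim: d => [|d IHd]; rewrite ?theta0 // mulrS thetaD IHd exprS.
have norm1 : `|theta x| = 1.
  have [p p_pr pcharFp] := finPcharP F.
  apply/eqP; rewrite -(@pexpr_eq1 _ _ p) ?prime_gt0 //.
  by rewrite -normrX -theta_nat mulrn_pchar // theta0 normr1.
by rewrite thetaN invC_norm norm1 expr1n invr1 mul1r.
Qed.

Variable n : nat.
Local Notation V := 'M[F]_n.
Implicit Types (b c : {set V}) (l : V -> F) (lam : {ffun V -> F}).

(** Values outside [b] are left free, in contrast with [dual], so that one form on g can serve on
    each of its subspaces without truncation. *)
Definition lin_on b l :=
  forall (a : F) x y, x \in b -> y \in b -> l (a *: x + y) = a * l x + l y.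

Lemma dualP b lam :
  reflect ((forall x, x \notin b -> lam x = 0) /\ lin_on b lam)
          (lam \in dual b).
Proof.
rewrite inE; apply: (iffP andP) => [[/forallP l0 /forallP lD] | [l0 lD]].
  split=> [x /(implyP (l0 x))/eqP // | a x y bx by_].
  have /forall_inP/(_ x bx)/forall_inP/(_ y by_)/eqP := lD a; exact.
split; first by apply/forallP=> x; apply/implyP=> /l0->.
apply/forallP=> a; apply/forall_inP=> x bx; apply/forall_inP=> y by_.
by rewrite lD.
Qed.

Lemma dual_lin b lam : lam \in dual b -> lin_on b lam.
Proof. by case/dualP. Qed.

Section Subspace.
Variable b : {set V}.
Hypotheses (b_sub : is_subspace b) (b0 : 0 \in b).

Lemma subspaceD x y : x \in b -> y \in b -> x + y \in b.
Proof. by move=> bx by_; rewrite -[x]scale1r b_sub. Qed.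

Lemma subspaceZ a x : x \in b -> a *: x \in b.
Proof. by move=> bx; rewrite -[_ *: x]addr0 b_sub. Qed.

Lemma subspaceN x : x \in b -> - x \in b.
Proof. by move=> bx; rewrite -scaleN1r subspaceZ. Qed.

Lemma lin_on0 l : lin_on b l -> l 0 = 0.
Proof.
move=> lD; have := lD 1 _ _ b0 b0.
by rewrite scale1r addr0 mul1r => /(congr1 (+%R^~ (- l 0))); rewrite addrK subrr.
Qed.

Lemma lin_onD l : lin_on b l -> {in b &, forall x y, l (x + y) = l x + l y}.
Proof. by move=> lD x y bx by_; rewrite -[x]scale1r lD // mul1r scale1r. Qed.

Lemma lin_onZ l : lin_on b l -> {in b, forall x a, l (a *: x) = a * l x}.
Proof. by move=> lD x bx a; rewrite -[_ *: x]addr0 lD // lin_on0 // addr0. Qed.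

Lemma lin_onN l : lin_on b l -> {in b, forall x, l (- x) = - l x}.
Proof. by move=> lD x bx; rewrite -scaleN1r lin_onZ // mulN1r. Qed.

Lemma sum_multiplicative (phi : V -> algC) :
  {in b &, forall x y, phi (x + y) = phi x * phi y} ->
  \sum_(x in b) phi x = #|b|%:R *+ [forall x in b, phi x == 1].
Proof.
move=> phiD; have [/forall_inP phi1 | ] := boolP [forall x in b, phi x == 1].
  rewrite (eq_bigr (fun=> 1)) ?sumr_const // => x bx.
  by apply/eqP/phi1.
rewrite negb_forall => /existsP[x0]; rewrite negb_imply => /andP[bx0 phi_x0].
have: phi x0 * (\sum_(x in b) phi x) = \sum_(x in b) phi x.
  rewrite [RHS](reindex_inj (addrI x0)) mulr_sumr /=.
  apply: eq_big => [x | x bx]; last by rewrite phiD.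
  apply/idP/idP=> [|b_x]; first exact: subspaceD.
  by rewrite -(addKr x0 x) subspaceD ?subspaceN.
move/eqP; rewrite -subr_eq0 -{2}[\sum_(x in b) _]mul1r -mulrBl mulf_eq0.
by rewrite subr_eq0 (negPf phi_x0) => /eqP->.
Qed.

(** A nonzero value of [l] can be scaled inside [b] to any element of [F], which would make [theta]
    trivial. This is how statements about characters become statements about forms. *)
Lemma theta_lin_eq1 l :
  lin_on b l -> (forall x, x \in b -> theta (l x) = 1) ->
  forall x, x \in b -> l x = 0.
Proof.
move=> lD l1 x bx; apply/eqP; apply: contraT => lx0.
have [a /negP[]] := theta_neq1.
by rewrite -[a](mulfVK lx0) -lin_onZ // l1 ?subspaceZ.
Qed.

Lemma sum_theta_lin l : lin_on b l ->
  \sum_(x in b) theta (l x) = #|b|%:R *+ [forall x in b, l x == 0].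
Proof.
move=> lD; rewrite (sum_multiplicative (phi := theta \o l)) => [|x y bx by_].
  congr (_ *+ nat_of_bool _); apply/forall_inP/forall_inP=> l0 x bx; last first.
    by rewrite /= (eqP (l0 x bx)) theta0.
  by rewrite (theta_lin_eq1 lD) // => y by_; apply/eqP/l0.
by rewrite /= lin_onD.
Qed.

Lemma dual0 : 0 \in dual b.
Proof.
by apply/dualP; split=> [x _ | a x y _ _]; rewrite !ffunE ?mulr0 ?addr0.
Qed.

Lemma dualD lam mu : lam \in dual b -> mu \in dual b -> lam + mu \in dual b.
Proof.
move=> /dualP[l0 lD] /dualP[m0 mD].
apply/dualP; split=> [x nbx | a x y bx by_]; rewrite !ffunE.
  by rewrite l0 ?m0 ?addr0.
by rewrite lD ?mD // mulrDr addrACA.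
Qed.

Lemma dualN lam : lam \in dual b -> - lam \in dual b.
Proof.
move=> /dualP[l0 lD].
apply/dualP; split=> [x nbx | a x y bx by_]; rewrite !ffunE.
  by rewrite l0 ?oppr0.
by rewrite lD // opprD mulrN.
Qed.

Lemma dual_restr l : lin_on b l -> [ffun x => l x *+ (x \in b)] \in dual b.
Proof.
move=> lD; apply/dualP; split=> [x /negPf nbx | a x y bx by_]; rewrite !ffunE.
  by rewrite nbx.
by rewrite bx by_ b_sub // !mulr1n lD.
Qed.

Lemma dual_separates x : x \in b -> x != 0 ->
  exists2 lam, lam \in dual b & theta (lam x) != 1.
Proof.
move=> bx; rewrite -[_ != _]negbK; have [t t1] := theta_neq1.
case: (boolP [forall i, forall j, x i j == 0]) => [/'forall_forallP x0 | ].
  by case/negP; apply/negPn/eqP/matrixP=> i j; rewrite mxE (eqP (x0 i j)).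
rewrite negb_forall => /existsP[i]; rewrite negb_forall => /existsP[j xij] _.
(* The form reads off a nonzero entry of [x], scaled to take at [x] a value [t] with
   [theta t != 1]. *)
exists [ffun y : V => t * y i j / x i j *+ (y \in b)].
  apply: (@dual_restr (fun y : V => t * y i j / x i j)) => a y z _ _.
  by rewrite !mxE mulrDr mulrDl [t * (a * _)]mulrCA -!mulrA.
by rewrite ffunE bx mulr1n mulfK.
Qed.

Lemma sum_theta_dual x : x \in b ->
  \sum_(lam in dual b) theta (lam x) = #|dual b|%:R *+ (x == 0).
Proof.
move=> bx; case: eqP => [-> | /eqP x0].
  rewrite (eq_bigr (fun=> 1)) ?sumr_const // => lam /dual_lin/lin_on0->.
  exact: theta0.
have [mu Dmu mu_x] := dual_separates bx x0; rewrite mulr0n.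
have: theta (mu x) * (\sum_(lam in dual b) theta (lam x))
      = \sum_(lam in dual b) theta (lam x).
  rewrite [RHS](reindex_inj (addrI mu)) mulr_sumr /=.
  apply: eq_big => [lam | lam Dlam]; last by rewrite ffunE thetaD.
  apply/idP/idP=> [|Dl]; first exact: dualD.
  by rewrite -(addKr mu lam) dualD ?dualN.
move/eqP; rewrite -subr_eq0 -{2}[\sum_(x in _) _]mul1r -mulrBl mulf_eq0.
by rewrite subr_eq0 (negPf mu_x) => /eqP->.
Qed.

(** Double counting of [theta (lam x)] over all pairs: summing over [lam] first leaves only [x = 0],
    summing over [x] first leaves only [lam = 0]. *)
Lemma card_dual : #|dual b| = #|b|.
Proof.
apply/eqP; rewrite -(eqr_nat algC); apply/eqP.
transitivity (\sum_(lam in dual b) \sum_(x in b) theta (lam x)); last first.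
  rewrite (bigD1 (0 : {ffun V -> F})) ?dual0 //= [X in _ + X]big1 => [|lam /andP[Dlam nz_lam]].
    rewrite addr0 (eq_bigr (fun=> 1)) ?sumr_const // => x _.
    by rewrite ffunE theta0.
  rewrite sum_theta_lin; last exact: dual_lin.
  case: forall_inP => // l0; case/eqP: nz_lam; apply/ffunP=> x; rewrite ffunE.
  by have [/l0/eqP // | nbx] := boolP (x \in b); case/dualP: Dlam => ->.
rewrite exchange_big (bigD1 0) //= sum_theta_dual // eqxx mulr1n.
by rewrite big1 ?addr0 // => x /andP[bx /negPf x0]; rewrite sum_theta_dual ?x0.
Qed.

End Subspace.

(* Fourier inversion on [c]: the coefficients of [theta \o l] along the
   restrictions to [c] of the elements of [dual b] add up to something
   nonzero. *)
Lemma dual_extends b c l :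
  is_subspace b -> 0 \in b -> c \subset b -> is_subspace c -> 0 \in c ->
  lin_on c l -> exists2 lam, lam \in dual b & {in c, forall x, lam x = l x}.
Proof.
move=> b_sub b0 /subsetP sCB c_sub c0 lD.
have Dc lam : lam \in dual b -> lin_on c (fun x => lam x - l x).
  move=> /dual_lin Dlam a x y cx cy; rewrite lD // Dlam ?sCB //.
  by rewrite opprD addrACA -mulrN -mulrDr.
have : \sum_(lam in dual b) \sum_(x in c) theta (lam x - l x) != 0.
  rewrite exchange_big (bigD1 0) //= [X in _ + X]big1 ?addr0 => [|x /andP[cx /negPf x0]].
    under eq_bigr => lam _ do rewrite thetaD.
    rewrite -mulr_suml sum_theta_dual // eqxx mulf_neq0 // pnatr_eq0 -lt0n.
    by apply/card_gt0P; exists 0; apply: dual0.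
  under eq_bigr => lam _ do rewrite thetaD.
  by rewrite -mulr_suml sum_theta_dual ?sCB // x0 mul0r.
have [/exists_inP[lam Dlam lE] _ | ] :=
    boolP [exists lam in dual b, [forall x in c, lam x == l x]].
  by exists lam => // x cx; apply/eqP/(forall_inP lE).
rewrite negb_exists => /forallP noE /eqP[]; apply: big1 => lam Dlam.
have := noE lam; rewrite Dlam /= (sum_theta_lin c_sub c0 (Dc lam Dlam)).
case: forall_inP => // lE /forall_inP[] x cx.
by rewrite -subr_eq0 lE.
Qed.

End Fourier.

(** * Two-sided actions and supercharacter values *)

Section Actions.
Variables (F : finFieldType) (n : nat).
Local Notation gT := (UT F n).
Local Notation V := 'M[F]_n.
Implicit Types (L R A B : {group gT}) (lam : {ffun V -> F}).

Lemma ut_mulVK (g : gT) (x : V) : utval g^-1%g *m (utval g *m x) = x.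
Proof. by rewrite mulmxA -utM mulVg ut1 mul1mx. Qed.

Lemma ut_mulKV (g : gT) (x : V) : utval g *m (utval g^-1%g *m x) = x.
Proof. by rewrite mulmxA -utM mulgV ut1 mul1mx. Qed.

Lemma ut_mulmxK (g : gT) (x : V) : x *m utval g *m utval g^-1%g = x.
Proof. by rewrite -mulmxA -utM mulgV ut1 mulmx1. Qed.

Lemma ut_mulmx_injl (g : gT) : injective (fun x : V => utval g *m x).
Proof. by move=> x y /(congr1 (mulmx (utval g^-1%g))); rewrite !ut_mulVK. Qed.

Lemma ut_mulmx_injr (g : gT) : injective (fun x : V => x *m utval g).
Proof. by move=> x y /(congr1 (mulmx^~ (utval g^-1%g))); rewrite !ut_mulmxK. Qed.

Lemma lg1 : lg (1%g : gT) = 0. Proof. by rewrite /lg ut1 subrr. Qed.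

Lemma utE (g : gT) : utval g = 1%:M + lg g.
Proof. by rewrite addrC subrK. Qed.

Lemma lgM (g h : gT) : lg (g * h)%g = utval g *m lg h + lg g.
Proof. by rewrite /lg utM mulmxBr mulmx1 addrA subrK. Qed.

Lemma lg_inj : injective (@lg F n).
Proof. by move=> g h /addIr/val_inj. Qed.

Lemma lgJ (g h : gT) : lg (g ^ h)%g = utval h^-1%g *m lg g *m utval h.
Proof. by rewrite /lg mulmxBr mulmx1 mulmxBl -!utM mulVg conjgE mulgA. Qed.

Lemma alg_of0 B : 0 \in alg_of B.
Proof. by apply/imsetP; exists 1%g; rewrite ?lg1 ?group1. Qed.

Lemma mem_alg_of (B : {set gT}) g : (lg g \in alg_of B) = (g \in B).
Proof. by rewrite mem_imset //; apply: lg_inj. Qed.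

Lemma card_alg_of (B : {set gT}) : #|alg_of B| = #|B|.
Proof. exact/card_imset/lg_inj. Qed.

Lemma sum_alg_of (B : {set gT}) (f : V -> algC) :
  \sum_(x in alg_of B) f x = \sum_(g in B) f (lg g).
Proof. by rewrite big_imset //; apply: in2W; apply: lg_inj. Qed.

(** The inverse on the left factor turns two-sided multiplication into a right action of the product
    group, as the library's actions require. *)
Definition mx_act (x : V) (p : gT * gT) : V :=
  utval p.1^-1%g *m x *m utval p.2.

Lemma mx_actE x a b : mx_act x (a, b) = utval a^-1%g *m x *m utval b.
Proof. by []. Qed.

Fact mx_act_is_action : is_action setT mx_act.
Proof.
apply: is_total_action => [x | x [a b] [a' b']].
  by rewrite -[1%g]/(1%g, 1%g) mx_actE invg1 ut1 mul1mx mulmx1.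
rewrite -[((a, b) * (a', b'))%g]/((a * a')%g, (b * b')%g) !mx_actE.
by rewrite invMg !utM !mulmxA.
Qed.
Canonical mx_action := Action mx_act_is_action.

Lemma mx_actionE x a b :
  mx_action x (a, b) = utval a^-1%g *m x *m utval b.
Proof. by []. Qed.

(** The action contragredient to [mx_act]: [form_act lam p (mx_act x p) = lam x]. *)
Definition form_act lam (p : gT * gT) := dual_act p.1^-1%g lam p.2.

Lemma form_actE lam a b x :
  form_act lam (a, b) x = lam (utval a *m x *m utval b^-1%g).
Proof. by rewrite ffunE invgK. Qed.

Fact form_act_is_action : is_action setT form_act.
Proof.
apply: is_total_action => [lam | lam [a b] [a' b']]; apply/ffunP=> x.
  by rewrite -[1%g]/(1%g, 1%g) form_actE invg1 ut1 mul1mx mulmx1.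
rewrite -[((a, b) * (a', b'))%g]/((a * a')%g, (b * b')%g) !form_actE.
by rewrite invMg !utM !mulmxA.
Qed.
Canonical form_action := Action form_act_is_action.

Lemma form_actionE lam a b x :
  form_action lam (a, b) x = lam (utval a *m x *m utval b^-1%g).
Proof. exact: form_actE. Qed.

Lemma dual_orbitE L lam R :
  dual_orbit L lam R = orbit form_action (setX L R) lam.
Proof.
apply/setP=> mu; apply/imset2P/orbitP=> [[g h Lg Rh ->] | [[g h]]].
  exists (g^-1, h)%g; first by rewrite inE /= groupV Lg.
  by rewrite /= /form_act invgK.
rewrite inE /= => /andP[Lg Rh] <-.
by exists (g^-1)%g h; rewrite ?groupV.
Qed.

Lemma left_ideal_stable A B : left_ideal_subgroup B A ->
  {in A, forall a x, (utval a *m x \in alg_of B) = (x \in alg_of B)}.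
Proof.
case=> _ sB iB a Aa x.
suff st a' y : a' \in A -> y \in alg_of B -> utval a' *m y \in alg_of B.
  apply/idP/idP; last exact: st.
  by move/(st (a^-1)%g); rewrite ut_mulVK groupV; apply.
move=> Aa' By; rewrite utE mulmxDl mul1mx (subspaceD sB) //.
by rewrite iB ?mem_alg_of.
Qed.

Lemma right_ideal_stable A B : right_ideal_subgroup B A ->
  {in A, forall a x, (x *m utval a \in alg_of B) = (x \in alg_of B)}.
Proof.
case=> _ sB iB a Aa x.
suff st a' y : a' \in A -> y \in alg_of B -> y *m utval a' \in alg_of B.
  apply/idP/idP; last exact: st.
  by move/(st (a^-1)%g); rewrite ut_mulmxK groupV; apply.
move=> Aa' By; rewrite utE mulmxDr mulmx1 (subspaceD sB) //.
by rewrite iB ?mem_alg_of.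
Qed.

Variable theta : F -> algC.
Hypothesis theta_neq0 : forall x : F, theta x != 0.
Hypothesis thetaD : forall x y : F, theta (x + y) = theta x * theta y.
Hypothesis theta_neq1 : exists x : F, theta x != 1.

(* The normalizing factor is the common value of [|L| |R| / |L lam|] and
   [|L| |R| / |lam R|]. *)
Definition supval_norm L R lam : algC :=
  \sum_(g in L) \sum_(h in R) theta (lam (lg g *m lg h)).

Definition supval L R lam (x : V) : algC :=
  (supval_norm L R lam)^-1
    * \sum_(g in L) \sum_(h in R) theta (lam (utval g *m x *m utval h)).

Lemma orbit_sum_avg L R lam g :
  #|L|%:R * #|R|%:R * orbit_sum theta (dual_orbit L lam R) g
  = #|dual_orbit L lam R|%:R
    * \sum_(a in L) \sum_(b in R) theta (lam (utval a *m lg g *m utval b)).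
Proof.
rewrite /orbit_sum dual_orbitE -natrM -cardsX.
rewrite -(sum_orbit form_action _ _ (fun mu => theta (mu (lg g)))).
congr (_ * _); rewrite (pair_big_dep _ _ (fun a b => theta (lam (utval a *m _ *m utval b)))) /=.
(* Inverting the second coordinate removes the inverse that [form_act] puts on the right. *)
rewrite (reindex_inj (h := fun p : gT * gT => (p.1, p.2^-1)%g)) /=.
  apply: eq_big => [[a b] | [a b] _]; first by rewrite !inE /= groupV.
  by rewrite form_actionE invgK.
by apply: inv_inj => -[a b]; congr (_, _); apply: invgK.
Qed.

(** The scalar [c] is left open because the left ideal theory normalizes by the size of the orbit L
    lam and the right ideal theory by that of lam R. The hypothesis also forces [c] and
    [supval_norm] to be nonzero. *)
Lemma supval_orbit_sum L R lam g (c : algC) :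
  c * supval_norm L R lam = #|L|%:R * #|R|%:R ->
  c / #|dual_orbit L lam R|%:R * orbit_sum theta (dual_orbit L lam R) g
    = supval L R lam (lg g).
Proof.
move=> cE; have [nzL nzR] : #|L|%:R != 0 :> algC /\ #|R|%:R != 0 :> algC.
  by rewrite !pnatr_eq0 -!lt0n !cardG_gt0.
have nzS : c * supval_norm L R lam != 0 by rewrite cE mulf_neq0.
have [nzc {}nzS] : c != 0 /\ supval_norm L R lam != 0.
  by apply/andP; rewrite -negb_or -mulf_eq0.
have nzO : #|dual_orbit L lam R|%:R != 0 :> algC.
  by rewrite pnatr_eq0 -lt0n dual_orbitE; apply/card_gt0P; exists lam; apply: orbit_refl.
apply: (mulfI (mulf_neq0 nzL nzR)); rewrite mulrCA orbit_sum_avg.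
by rewrite mulrA mulfVK // -cE /supval !mulrA mulfK.
Qed.

(** For [a] in [A], the sum of [theta (lam (lg a *m x))] over the left ideal [alg_of B] is [#|B|] if
    [lam] vanishes on [lg a *m x] for all [x] there, that is if [a] fixes [lam], and 0 otherwise. So
    [supval_norm] is the order of the stabilizer of [lam] in [A] times [#|B|], and orbit-stabilizer
    concludes. *)
Lemma card_left_orbit A B lam :
  left_ideal_subgroup B A -> lam \in dual (alg_of B) ->
  #|dual_orbit A lam 1|%:R * supval_norm A B lam = #|A|%:R * #|B|%:R.
Proof.
move=> idB Dlam; have [sBA sB iB] := idB.
have normE : supval_norm A B lam
    = #|'C_(setX A 1%G)[lam | form_action]|%:R * #|B|%:R.
  rewrite /supval_norm.
  have -> : 'C_(setX A 1%G)[lam | form_action]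
      = setX [set a in A | [forall x in alg_of B, lam (lg a *m x) == 0]] 1%G.
    apply/setP=> -[a b]; rewrite !inE sub1set !inE /= andbAC.
    case: (b =P 1%g) => [-> | _]; rewrite ?andbF // !andbT.
    case: (boolP (a \in A)) => //= Aa; have stB := left_ideal_stable idB Aa.
    have lamZ x : x \in alg_of B -> lam (utval a *m x) = lam (lg a *m x) + lam x.
      move=> Bx; rewrite utE mulmxDl mul1mx addrC (lin_onD (dual_lin Dlam)) //.
      have: utval a *m x - x \in alg_of B.
        by rewrite (subspaceD sB) ?(subspaceN sB) ?alg_of0 // stB.
      by rewrite utE mulmxDl mul1mx addrC addKr.
    apply/eqP/forall_inP=> [fix_lam x Bx | l0].
      have := congr1 (fun f : {ffun _} => f x) fix_lam; rewrite form_actionE.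
      rewrite invg1 ut1 mulmx1 lamZ // => /(canRL (addrK _)).
      by rewrite subrr => ->.
    apply/ffunP=> x; rewrite form_actionE invg1 ut1 mulmx1.
    have [Bx | nBx] := boolP (x \in alg_of B).
      by rewrite lamZ // (eqP (l0 x Bx)) add0r.
    by case/dualP: Dlam => l0' _; rewrite !l0' // stB.
  rewrite cardsX cards1 muln1 -sum1_card natr_sum mulr_suml.
  rewrite [RHS](eq_bigl (fun a => (a \in A) &&
    [forall x in alg_of B, lam (lg a *m x) == 0])); last first.
    by move=> a; rewrite inE.
  rewrite [RHS]big_mkcondr; apply: eq_bigr => a Aa.
  rewrite -(sum_alg_of B (fun x => theta (lam (lg a *m x)))).
  rewrite (sum_theta_lin theta_neq0 thetaD theta_neq1 sB (alg_of0 B)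
             (l := fun x => lam (lg a *m x))); last first.
    move=> c x y Bx By; rewrite mulmxDr -scalemxAr (dual_lin Dlam) //.
      by rewrite iB ?mem_alg_of.
    by rewrite iB ?mem_alg_of.
  by case: ifP; rewrite card_alg_of ?mul1r.
rewrite normE mulrA -natrM dual_orbitE card_orbit_stab.
by rewrite cardsX cards1 muln1.
Qed.

(** The mirror image of [card_left_orbit]: the order of summation is exchanged so that the sum over
    the right ideal is again the inner one. *)
Lemma card_right_orbit A B lam :
  right_ideal_subgroup B A -> lam \in dual (alg_of B) ->
  #|dual_orbit 1 lam A|%:R * supval_norm B A lam = #|B|%:R * #|A|%:R.
Proof.
move=> idB Dlam; have [sBA sB iB] := idB.
have normE : supval_norm B A lam
    = #|'C_(setX 1%G A)[lam | form_action]|%:R * #|B|%:R.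
  rewrite /supval_norm exchange_big.
  have -> : 'C_(setX 1%G A)[lam | form_action]
      = setX 1%G [set a in A | [forall x in alg_of B, lam (x *m lg a^-1%g) == 0]].
    apply/setP=> -[b a]; rewrite !inE sub1set !inE /= -!andbA.
    case: (b =P 1%g) => [-> | //]; case: (boolP (a \in A)) => //= Aa.
    have stB := right_ideal_stable idB (groupVr Aa).
    have lamZ x : x \in alg_of B ->
        lam (x *m utval a^-1%g) = lam (x *m lg a^-1%g) + lam x.
      move=> Bx; rewrite utE mulmxDr mulmx1 addrC (lin_onD (dual_lin Dlam)) //.
      have: x *m utval a^-1%g - x \in alg_of B.
        by rewrite (subspaceD sB) ?(subspaceN sB) ?alg_of0 // stB.
      by rewrite utE mulmxDr mulmx1 addrC addKr.
    apply/eqP/forall_inP=> [fix_lam x Bx | l0].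
      have := congr1 (fun f : {ffun _} => f x) fix_lam; rewrite form_actionE.
      rewrite ut1 mul1mx lamZ // => /(canRL (addrK _)).
      by rewrite subrr => ->.
    apply/ffunP=> x; rewrite form_actionE ut1 mul1mx.
    have [Bx | nBx] := boolP (x \in alg_of B).
      by rewrite lamZ // (eqP (l0 x Bx)) add0r.
    by case/dualP: Dlam => l0' _; rewrite !l0' // stB.
  rewrite cardsX cards1 mul1n -sum1_card natr_sum mulr_suml.
  rewrite [RHS](eq_bigl (fun a => (a \in A) &&
    [forall x in alg_of B, lam (x *m lg a^-1%g) == 0])); last first.
    by move=> a; rewrite inE.
  rewrite [RHS](reindex_inj invg_inj) [RHS]big_mkcondr /=.
  rewrite [RHS](eq_bigl [in A]) => [|a]; last by rewrite groupV.
  apply: eq_bigr => a Aa. rewrite invgK.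
  rewrite -(sum_alg_of B (fun x => theta (lam (x *m lg a)))).
  rewrite (sum_theta_lin theta_neq0 thetaD theta_neq1 sB (alg_of0 B)
             (l := fun x => lam (x *m lg a))); last first.
    move=> c x y Bx By; rewrite mulmxDl -scalemxAl (dual_lin Dlam) //.
      by rewrite iB ?mem_alg_of.
    by rewrite iB ?mem_alg_of.
  by case: ifP; rewrite card_alg_of ?mul1r.
rewrite normE mulrA -natrM dual_orbitE card_orbit_stab.
by rewrite cardsX cards1 mul1n mulrC.
Qed.

Lemma left_supercharacterE A B (chi : 'CF(B)) : left_ideal_subgroup B A ->
  supercharacter (left_ideal_sct theta A B) chi <->
  exists2 lam, lam \in dual (alg_of B)
    & {in B, forall g, chi g = supval A B lam (lg g)}.
Proof.
move=> idB; split=> -[lam Dlam chiE]; exists lam => // g Bg; rewrite chiE //.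
  exact/supval_orbit_sum/card_left_orbit.
exact/esym/supval_orbit_sum/card_left_orbit.
Qed.

Lemma right_supercharacterE A B (chi : 'CF(B)) : right_ideal_subgroup B A ->
  supercharacter (right_ideal_sct theta A B) chi <->
  exists2 lam, lam \in dual (alg_of B)
    & {in B, forall g, chi g = supval B A lam (lg g)}.
Proof.
move=> idB; split=> -[lam Dlam chiE]; exists lam => // g Bg; rewrite chiE //.
  exact/supval_orbit_sum/card_right_orbit.
exact/esym/supval_orbit_sum/card_right_orbit.
Qed.

(** * The algebra group supercharacter theory *)

Section AlgebraGroupTheory.
Variable G : {group gT}.
Hypothesis idG : left_ideal_subgroup G G.
Local Notation frg := (alg_of G).

Let gsub : is_subspace frg. Proof. by case: idG. Qed.

Let g0 : 0 \in frg. Proof. exact: alg_of0. Qed.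

Let gmull : {in G, forall a x, (utval a *m x \in frg) = (x \in frg)}.
Proof. exact: left_ideal_stable. Qed.

Let gmulr : {in G, forall a x, (x *m utval a \in frg) = (x \in frg)}.
Proof.
apply: right_ideal_stable; case: idG => sGG sg ig.
by split=> // a x ga gx; apply: ig.
Qed.

Let gM x y : x \in frg -> y \in frg -> x *m y \in frg.
Proof. by case: idG => _ _; apply. Qed.

Lemma sum_translate L R a b lam x : a \in L -> b \in R ->
  \sum_(g in L) \sum_(h in R)
     theta (lam (utval g *m (utval a *m x *m utval b) *m utval h))
  = \sum_(g in L) \sum_(h in R) theta (lam (utval g *m x *m utval h)).
Proof.
move=> La Rb; rewrite [RHS](reindex_inj (mulIg a)) /=.
apply: eq_big => [g | g Lg]; first by rewrite groupMr.
rewrite [RHS](reindex_inj (mulgI b)) /=.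
apply: eq_big => [h | h Rh]; first by rewrite groupMl.
by rewrite !utM !mulmxA.
Qed.

Lemma supval_translate L R a b lam x : a \in L -> b \in R ->
  supval L R lam (utval a *m x *m utval b) = supval L R lam x.
Proof. by move=> La Rb; rewrite /supval sum_translate. Qed.

(** Moving [lam] within its two-sided orbit only relabels the summation variables, so the value
    depends on the orbit alone. *)
Lemma supval_orbit lam a b x : a \in G -> b \in G ->
  supval G G (form_action lam (a, b)) x = supval G G lam x.
Proof.
move=> Ga Gb; congr (_^-1 * _).
  (* On the elements [lg g], multiplication by [a] is not a translation of the group; on the algebra
     it is a bijection, so the constant is first rewritten as a sum over the algebra. *)
  have normE mu : supval_norm G G mu
      = \sum_(y in frg) \sum_(z in frg) theta (mu (y *m z)).
    by rewrite sum_alg_of; apply: eq_bigr => g _; rewrite sum_alg_of.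
  rewrite !normE [RHS](reindex_inj (@ut_mulmx_injl a)) /=.
  apply: eq_big => [y | y gy]; first by rewrite gmull.
  rewrite [RHS](reindex_inj (@ut_mulmx_injr b^-1%g)) /=.
  apply: eq_big => [z | z gz]; first by rewrite gmulr ?groupV.
  by rewrite form_actionE !mulmxA.
rewrite [RHS](reindex_inj (mulgI a)) /=.
apply: eq_big => [g | g Gg]; first by rewrite groupMl.
rewrite [RHS](reindex_inj (mulIg b^-1%g)) /=.
apply: eq_big => [h | h Gh]; first by rewrite groupMr ?groupV.
by rewrite form_actionE !utM !mulmxA.
Qed.

Lemma mem_dual_orbit L R lam mu :
  reflect (exists2 p, (p.1 \in L) && (p.2 \in R) & mu = form_action lam p)
          (mu \in dual_orbit L lam R).
Proof.
rewrite dual_orbitE; apply: (iffP orbitP) => [[[a b]] | [[a b] /= Lab ->]].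
  by rewrite inE => Lab <-; exists (a, b).
by exists (a, b); rewrite ?inE.
Qed.

Lemma form_action_dual lam a b : a \in G -> b \in G ->
  (form_action lam (a, b) \in dual frg) = (lam \in dual frg).
Proof.
suff st mu c d : c \in G -> d \in G -> mu \in dual frg ->
    form_action mu (c, d) \in dual frg.
  move=> Ga Gb; apply/idP/idP; last exact: st.
  move/(st _ (a^-1)%g (b^-1)%g); rewrite !groupV => /(_ Ga Gb).
  by rewrite -[(a^-1, b^-1)%g]/((a, b)^-1)%g actK.
move=> Gc Gd /dualP[m0 mD]; apply/dualP; split=> [x nGx | t x y Gx Gy].
  by rewrite form_actionE m0 // gmulr ?groupV // gmull.
rewrite !form_actionE -mD ?gmulr ?gmull ?groupV //.
by rewrite mulmxDr mulmxDl -scalemxAr -scalemxAl.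
Qed.

Lemma supval_norm_neq0 lam : lam \in dual frg -> supval_norm G G lam != 0.
Proof.
move=> Dlam; have := card_left_orbit idG Dlam.
apply: contra_eq_neq => ->; rewrite mulr0 eq_sym mulf_neq0 //;
by rewrite pnatr_eq0 -lt0n cardG_gt0.
Qed.

(** For fixed [a], the sum over [h] is a full character sum over the algebra; it vanishes unless [x]
    fixes the form [form_action lam (a, 1%g)]. What remains is the trace of the monomial
    representation on the left orbit of [lam]. *)
Lemma supval_monomial lam x : lam \in dual frg -> x \in G ->
  supval G G lam (lg x)
  = \sum_(mu in dual_orbit G lam 1 | form_action mu (x, 1%g) == mu)
       theta (mu (lg x)).
Proof.
move=> Dlam Gx; have Glam := card_left_orbit idG Dlam.
have nzS := supval_norm_neq0 Dlam.
have nzG : #|G|%:R != 0 :> algC by rewrite pnatr_eq0 -lt0n cardG_gt0.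
have nzO : #|dual_orbit G lam 1|%:R != 0 :> algC.
  by apply: contra_eq_neq Glam => ->; rewrite mul0r eq_sym mulf_neq0.
pose c mu : algC := if form_action mu (x, 1%g) == mu then theta (mu (lg x)) else 0.
have sum_c : #|dual_orbit G lam 1|%:R * \sum_(a in G) c (form_action lam (a, 1%g))
    = #|G|%:R * \sum_(mu in dual_orbit G lam 1) c mu.
  rewrite dual_orbitE -[in RHS](muln1 #|G|) -[in RHS](cards1 (1%g : gT)) -cardsX.
  rewrite -sum_orbit; congr (_ * _).
  transitivity (\sum_(a in G) \sum_(b in [set 1%g]) c (form_action lam (a, b))).
    by apply: eq_bigr => a _; rewrite big_set1.
  rewrite pair_big_dep /=; apply: eq_big => [[a b] | [a b] _ //].
  by rewrite !inE.
have c_E a : a \in G -> \sum_(h in G) theta (lam (utval a *m lg x *m utval h))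
    = #|G|%:R * c (form_action lam (a, 1%g)).
  move=> Ga; have ax : utval a *m lg x \in frg by rewrite gmull ?mem_alg_of.
  (* Splitting [utval h] as the identity plus [lg h] separates the constant factor from the sum over
     the algebra. *)
  rewrite (eq_bigr (fun h => theta (lam (utval a *m lg x *m lg h))
                             * theta (lam (utval a *m lg x)))); last first.
    move=> h Gh; rewrite [utval h]utE mulmxDr mulmx1 addrC -thetaD.
    by rewrite (lin_onD (dual_lin Dlam)) // gM // mem_alg_of.
  rewrite -mulr_suml.
  rewrite -(sum_alg_of G (fun y => theta (lam (utval a *m lg x *m y)))).
  rewrite (sum_theta_lin theta_neq0 thetaD theta_neq1 gsub g0
    (l := fun y => lam (utval a *m lg x *m y))); last first.
    by move=> t y z gy gz; rewrite mulmxDr -scalemxAr (dual_lin Dlam) //; apply: gM.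
  rewrite card_alg_of -mulr_natr -mulrA; congr (_ * _).
  rewrite /c mulr_natl mulrb form_actionE invg1 ut1 mulmx1.
  congr (if _ then _ else _); apply/forall_inP/eqP=> [l0 | fixlam y gy].
    apply/ffunP=> y; rewrite !form_actionE invg1 ut1 !mulmx1 [utval x]utE mulmxDl mul1mx.
    have [gy | ngy] := boolP (y \in frg).
      rewrite mulmxDr (lin_onD (dual_lin Dlam)) ?gmull //; last first.
        by rewrite gM // mem_alg_of.
      by rewrite mulmxA (eqP (l0 y gy)) addr0.
    case/dualP: Dlam => lam0 _; rewrite -{1}[y]mul1mx -mulmxDl -utE.
    by rewrite !lam0 // !gmull.
  have := congr1 (fun f : {ffun _} => f y) fixlam.
  rewrite !form_actionE invg1 ut1 !mulmx1 [utval x]utE mulmxDl mul1mx mulmxDr.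
  rewrite (lin_onD (dual_lin Dlam)) ?gmull //; last by rewrite gM // mem_alg_of.
  by move/(canRL (addKr _)); rewrite mulmxA addNr => ->.
have SE : supval_norm G G lam * supval G G lam (lg x)
    = #|G|%:R * \sum_(a in G) c (form_action lam (a, 1%g)).
  by rewrite /supval mulVKf // mulr_sumr; apply: eq_bigr => a /c_E.
apply: (mulfI (mulf_neq0 nzO nzS)); rewrite -[LHS]mulrA SE mulrCA sum_c.
by rewrite mulrA Glam big_mkcondr.
Qed.

Lemma supval_cfun lam : exists chi : 'CF(G), {in G, forall x, chi x = supval G G lam (lg x)}.
Proof.
by apply: cfun_exists => x y Gx Gy; rewrite lgJ supval_translate ?groupV.
Qed.

(** As [lg (x * y)] is [utval x *m lg y + lg x], translation by [x] permutes the functions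
    [theta \o mu \o lg], with [mu] in the left orbit of [lam], up to the scalars
    [theta (mu (lg x))]. These scalars are the cocycle. *)
Lemma supval_char lam (chi : 'CF(G)) : lam \in dual frg ->
  {in G, forall x, chi x = supval G G lam (lg x)} -> chi \is a character.
Proof.
move=> Dlam chiE.
apply: (char_monomial (Om := dual_orbit G lam 1)
  (to := fun mu x => form_action mu (x, 1%g)) (c := fun mu x => theta (mu (lg x)))).
- move=> mu x /mem_dual_orbit[[a b] /= /andP[Ga /set1P->] ->] Gx.
  apply/mem_dual_orbit; exists (a * x, 1)%g; first by rewrite /= groupM ?group1.
  by rewrite -actM; congr (form_action _ (_, _)); rewrite mulg1.
- by move=> mu _; apply: act1.
- move=> mu x y _ Gx Gy; rewrite -actM; congr (form_action _ (_, _)).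
  by rewrite mulg1.
- move=> mu /mem_dual_orbit[[a b] /= /andP[Ga /set1P->] ->].
  by rewrite form_actionE lg1 mulmx0 mul0mx (lin_on0 g0 (dual_lin Dlam)) theta0.
- move=> mu x y /mem_dual_orbit[[a b] /= /andP[Ga /set1P->] ->] Gx Gy.
  rewrite !form_actionE invg1 ut1 !mulmx1 lgM mulmxDr.
  by rewrite (lin_onD (dual_lin Dlam)) ?gmull ?mem_alg_of // thetaD mulrC.
by move=> x Gx; rewrite chiE // supval_monomial.
Qed.

(** After expanding both values, the sum over [x] for fixed [a, b, c, d] vanishes unless the
    translates of [lam] by [a, b] and of [mu] by [c, d] agree on g, which would put both forms in
    one orbit. *)
Lemma supval_ortho lam mu (chi psi : 'CF(G)) :
  lam \in dual frg -> mu \in dual frg ->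
  {in G, forall x, chi x = supval G G lam (lg x)} ->
  {in G, forall x, psi x = supval G G mu (lg x)} ->
  mu \notin dual_orbit G lam G -> '[chi, psi] = 0.
Proof.
move=> Dlam Dmu chiE psiE nmu; rewrite cfdotE.
pose t := supval_norm G G.
transitivity (#|G|%:R^-1 * ((t lam)^-1 * ((t mu)^-1)^* *
  \sum_(a in G) \sum_(b in G) \sum_(c in G) \sum_(d in G) \sum_(x in G)
    theta (lam (utval a *m lg x *m utval b) - mu (utval c *m lg x *m utval d)))).
  congr (_ * _); under eq_bigr => x Gx do rewrite chiE // psiE // /supval
    rmorphM mulrACA.
  rewrite -mulr_sumr; congr (_ * _).
  under eq_bigr => x _ do rewrite mulr_suml.
  rewrite exchange_big; apply: eq_bigr => a _.
  under eq_bigr => x _ do rewrite mulr_suml.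
  rewrite exchange_big; apply: eq_bigr => b _.
  under eq_bigr => x _ do rewrite raddf_sum mulr_sumr.
  rewrite exchange_big; apply: eq_bigr => c _.
  under eq_bigr => x _ do rewrite raddf_sum mulr_sumr.
  rewrite exchange_big; apply: eq_bigr => d _.
  by apply: eq_bigr => x _; rewrite thetaD -conj_theta.
rewrite big1 ?mulr0 // => a Ga; apply: big1 => b Gb.
apply: big1 => c Gc; apply: big1 => d Gd.
pose l (y : V) := lam (utval a *m y *m utval b) - mu (utval c *m y *m utval d).
rewrite -(sum_alg_of G (fun y => theta (l y))).
rewrite (sum_theta_lin theta_neq0 thetaD theta_neq1 gsub g0); last first.
  move=> e y z gy gz; rewrite /l !mulmxDr !mulmxDl -!scalemxAr -!scalemxAl.
  rewrite (dual_lin Dlam) ?gmulr ?gmull // (dual_lin Dmu) ?gmulr ?gmull //.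
  by rewrite opprD addrACA -mulrN -mulrDr.
case: forall_inP => // l0; case/mem_dual_orbit: nmu.
(* Obtained by solving [lam (a y b) = mu (c y d)] for [mu]: replace y by [c^-1 y d^-1]. *)
exists (a * c^-1, b^-1 * d)%g; first by rewrite !groupM ?groupV.
apply/ffunP=> y; rewrite form_actionE invMg invgK !utM.
have [gy | ngy] := boolP (y \in frg); last first.
  case/dualP: Dmu Dlam => -> // _ /dualP[-> //].
  by rewrite -!utM gmulr ?groupM ?groupV // gmull ?groupM ?groupV.
have /l0 : utval c^-1%g *m y *m utval d^-1%g \in frg.
  by rewrite gmulr ?groupV // gmull ?groupV.
have {2}-> : y = utval c *m (utval c^-1%g *m y *m utval d^-1%g) *m utval d.
  by rewrite -!mulmxA ut_mulKV -utM mulVg ut1 mulmx1.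
by rewrite /l subr_eq0 => /eqP <-; rewrite !mulmxA.
Qed.

(** Weighted by their constants, the values add up to a multiple of the regular character. This
    replaces a decomposition of the regular representation. *)
Lemma sum_supval x : x \in G ->
  \sum_(lam in dual frg) supval_norm G G lam * supval G G lam (lg x)
    = #|G|%:R * #|G|%:R * (#|dual frg|%:R *+ (x == 1%g)).
Proof.
move=> Gx; under eq_bigr => lam Dlam do
  rewrite /supval mulVKf ?supval_norm_neq0 //.
rewrite exchange_big -mulrA mulr_natl -sumr_const; apply: eq_bigr => a Ga.
rewrite exchange_big mulr_natl -sumr_const; apply: eq_bigr => b Gb.
rewrite (sum_theta_dual theta_neq0 thetaD theta_neq1) //; last first.
  by rewrite gmulr // gmull // mem_alg_of.
congr (_ *+ nat_of_bool _); apply/eqP/eqP=> [axb0 | ->]; last first.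
  by rewrite lg1 mulmx0 mul0mx.
apply: lg_inj; apply: (@ut_mulmx_injl a); apply: (@ut_mulmx_injr b).
by rewrite axb0 lg1 mulmx0 mul0mx.
Qed.

(** By [sum_supval] only [x = 1] contributes to the pairing of the weighted sum with ['chi_i], and
    it contributes a nonzero multiple of the conjugate degree. Hence some single [lam] pairs
    nontrivially with ['chi_i]. *)
Lemma supval_cover (i : Iirr G) :
  exists2 lam, lam \in dual frg &
    forall chi : 'CF(G), {in G, forall x, chi x = supval G G lam (lg x)} ->
      i \in irr_constt chi.
Proof.
pose dot lam := \sum_(x in G) supval G G lam (lg x) * ('chi_i x)^*.
have: \sum_(lam in dual frg) supval_norm G G lam * dot lam != 0.
  under eq_bigr => lam _ do rewrite mulr_sumr.
  rewrite exchange_big (bigD1 1%g) //= [X in _ + X]big1 ?addr0; last first.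
    move=> x /andP[Gx /negPf x1]; under eq_bigr => lam _ do rewrite mulrA.
    by rewrite -mulr_suml sum_supval // x1 mulr0 mul0r.
  under eq_bigr => lam _ do rewrite mulrA.
  rewrite -mulr_suml sum_supval // eqxx.
  rewrite !mulf_neq0 ?conjC_eq0 ?irr1_neq0 // pnatr_eq0 -lt0n ?cardG_gt0 //.
  by apply/card_gt0P; exists 0; apply: dual0.
case: (boolP [exists lam in dual frg, dot lam != 0]) => [|noE]; last first.
  rewrite big1 ?eqxx // => lam Dlam; move: noE; rewrite negb_exists.
  by move/forallP/(_ lam); rewrite Dlam negbK => /eqP->; rewrite mulr0.
case/exists_inP=> lam Dlam nz _; exists lam => // chi chiE.
rewrite irr_consttE cfdotE mulf_neq0 ?invr_eq0 ?pnatr_eq0 -?lt0n ?cardG_gt0 //.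
by rewrite (eq_bigr _ (fun x Gx => congr1 (fun t => t * _) (chiE x Gx))).
Qed.

(** Double counting of [theta (lam (ab x - x))]: summing over the forms counts fixed vectors,
    summing over the vectors counts fixed forms. It is the permutation-lemma argument for an action
    and its dual. *)
Lemma card_fix (a b : gT) : a \in G -> b \in G ->
  #|'Fix_(frg | mx_action)[(a, b)%g]| = #|'Fix_(dual frg | form_action)[(a, b)%g]|.
Proof.
move=> Ga Gb; apply/eqP; rewrite -(eqr_nat algC); apply/eqP.
have nzg : #|frg|%:R != 0 :> algC by rewrite pnatr_eq0 -lt0n; apply/card_gt0P; exists 0.
pose ab (x : V) := utval a *m x *m utval b^-1%g.
have gab x : x \in frg -> ab x \in frg by move=> gx; rewrite gmulr ?groupV // gmull.
apply: (mulfI nzg); transitivity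
    (\sum_(x in frg) \sum_(lam in dual frg) theta (lam (ab x - x))).
  rewrite mulr_natr -sumr_const; under [RHS]eq_bigr => x gx do rewrite
    (sum_theta_dual theta_neq0 thetaD theta_neq1 gsub g0)
    ?(subspaceD gsub) ?(subspaceN gsub) ?gab //
    (card_dual theta_neq0 thetaD theta_neq1) //.
  rewrite [LHS](eq_bigl (fun x => (x \in frg) && (ab x - x == 0))).
    by rewrite [LHS]big_mkcondr; apply: eq_bigr => x gx; rewrite mulrb.
  move=> x; rewrite !inE sub1set inE; congr (_ && _).
  rewrite subr_eq0 /ab; apply/eqP/eqP=> [E | E].
    by rewrite -{1}E mx_actionE -!mulmxA ut_mulKV -utM mulgV ut1 mulmx1.
  by rewrite mx_actionE -{1}E -!mulmxA ut_mulVK -utM mulVg ut1 mulmx1.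
rewrite exchange_big mulr_natr -sumr_const.
rewrite [RHS](eq_bigl (fun lam => (lam \in dual frg) &&
                        [forall x in frg, lam (ab x) - lam x == 0])).
  rewrite [RHS]big_mkcondr; apply: eq_bigr => lam Dlam; rewrite -mulrb.
  rewrite -(sum_theta_lin theta_neq0 thetaD theta_neq1 gsub g0
             (l := fun x => lam (ab x) - lam x)); last first.
    move=> e y z gy gz; rewrite /ab mulmxDr mulmxDl -scalemxAr -scalemxAl.
    rewrite !(dual_lin Dlam) ?gab // opprD addrACA -mulrN -mulrDr.
    by [].
  apply: eq_bigr => x gx; rewrite (lin_onD (dual_lin Dlam)) ?gab //.
    by rewrite (lin_onN g0 (dual_lin Dlam)).
  exact: subspaceN.
move=> lam; rewrite in_setI (sameP afix1P eqP).
case: (boolP (lam \in dual frg)) => //= Dlam.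
apply/eqP/forall_inP=> [fixlam x gx | l0].
  by rewrite -[in X in _ - X]fixlam form_actionE subrr.
apply/ffunP=> x; rewrite form_actionE.
have [gx | ngx] := boolP (x \in frg).
  by apply/eqP; rewrite -subr_eq0 l0.
by case/dualP: Dlam => l0' _; rewrite !l0' // gmulr ?groupV // gmull.
Qed.

(** Superclasses are the two-sided orbits on the algebra, pulled back along [lg]. Orbit counting by
    fixed points on both sides reduces the equality to [card_fix]. *)
Lemma card_supercharacters :
  #|[set dual_orbit G lam G | lam in dual frg]|
  = #|superclasses (algebra_group_sct theta G)|.
Proof.
have -> : superclasses (algebra_group_sct theta G)
    = (fun O : {set V} => [set h in G | lg h \in O])
        @: (orbit mx_action (setX G G) @: frg).
  rewrite /= -!imset_comp; apply: eq_imset => g; apply/setP=> h.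
  rewrite !inE; case: (h \in G) => //=.
  apply/exists_inP/orbitP=> [[a Ga /exists_inP[b Gb /eqP->]] | [[a b]]].
    exists (a^-1, b)%g; first by rewrite inE /= groupV Ga.
    by rewrite /= mx_actionE invgK.
  rewrite inE /= => /andP[Ga Gb] <-; exists (a^-1)%g; rewrite ?groupV //.
  by apply/exists_inP; exists b.
rewrite [RHS]card_in_imset; last first.
  move=> _ _ /imsetP[x gx ->] /imsetP[y _ ->].
  have /imsetP[g Gg ->] : x \in @lg F n @: G := gx.
  move/setP/(_ g); rewrite !inE Gg orbit_refl /= => /esym.
  exact/orbit_eqP.
have actV : [acts setX G G, on frg | mx_action].
  apply/actsP=> -[a b]; rewrite inE /= => /andP[Ga Gb] x.
  by rewrite /= mx_actionE gmulr // gmull // groupV.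
have actD : [acts setX G G, on dual frg | form_action].
  apply/actsP=> -[a b]; rewrite inE /= => /andP[Ga Gb] lam.
  exact: form_action_dual.
apply/eqP; rewrite -(eqn_pmul2r (cardG_gt0 (setX_group G G))) /=; apply/eqP.
rewrite -(Frobenius_Cauchy actV).
rewrite (eq_imset _ (fun lam => dual_orbitE G lam G)) -(Frobenius_Cauchy actD).
apply: eq_bigr => -[a b]; rewrite inE /= => /andP[Ga Gb].
by rewrite card_fix.
Qed.

Lemma algebra_group_is_sct : is_sct (algebra_group_sct theta G).
Proof.
have [ch chE] := fin_all_exists supval_cfun.
have sctE chi : supercharacter (algebra_group_sct theta G) chi
    <-> exists2 lam, lam \in dual frg & chi = ch lam.
  apply: iff_trans (left_supercharacterE chi idG) _.
  split=> -[lam Dlam chiE]; exists lam => //; last by rewrite chiE.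
  by apply/cfun_inP=> x Gx; rewrite chiE ?chE.
have ch_char lam : lam \in dual frg -> ch lam \is a character.
  by move=> Dlam; apply: (supval_char Dlam).
have ch_neq0 lam : lam \in dual frg -> ch lam != 0.
  move=> Dlam; apply/eqP=> /cfunP/(_ 1%g)/eqP; rewrite cfunE chE //.
  rewrite /supval mulf_eq0 invr_eq0 (negPf (supval_norm_neq0 Dlam)) /=.
  rewrite (eq_bigr (fun=> #|G|%:R)) => [|a _].
    by rewrite sumr_const -mulrnA pnatr_eq0 muln_eq0 !eqn0Ngt cardG_gt0.
  rewrite -sumr_const; apply: eq_bigr => b _.
  by rewrite lg1 mulmx0 mul0mx (lin_on0 g0 (dual_lin Dlam)) theta0.
have ch_orbit lam mu : mu \in dual_orbit G lam G -> ch mu = ch lam.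
  case/mem_dual_orbit=> -[a b] /= /andP[Ga Gb] ->.
  by apply/cfun_inP=> x Gx; rewrite !chE // supval_orbit.
have ch_ortho lam mu : lam \in dual frg -> mu \in dual frg ->
    mu \notin dual_orbit G lam G -> '[ch lam, ch mu] = 0.
  by move=> Dlam Dmu; apply: supval_ortho.
have ch_eq lam mu : lam \in dual frg -> mu \in dual frg ->
    ch lam = ch mu -> mu \in dual_orbit G lam G.
  move=> Dlam Dmu Ech; apply: contraT => /(ch_ortho _ _ Dlam Dmu)/eqP.
  by rewrite -Ech cfnorm_eq0 (negPf (ch_neq0 _ Dlam)).
split.
- apply: (equivalence_partitionP (R := fun g h => [exists a in G,
    [exists b in G, lg h == utval a *m lg g *m utval b]])).
  move=> x y z Gx Gy Gz; split.
    apply/exists_inP; exists 1%g; rewrite ?group1 //.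
    by apply/exists_inP; exists 1%g; rewrite ?group1 // ut1 mul1mx mulmx1.
  case/exists_inP=> a Ga /exists_inP[b Gb /eqP xy].
  apply/exists_inP/exists_inP=> -[c Gc /exists_inP[d Gd /eqP xz]].
    exists (c * a^-1)%g; first by rewrite groupM ?groupV.
    apply/exists_inP; exists (b^-1 * d)%g; first by rewrite groupM ?groupV.
    by rewrite xz xy !utM -!mulmxA ut_mulVK (mulmxA (utval b)) -utM mulgV ut1 mul1mx.
  exists (c * a)%g; first by rewrite groupM.
  apply/exists_inP; exists (b * d)%g; first by rewrite groupM.
  by rewrite xz xy !utM !mulmxA.
- move=> _ x /imsetP[g Gg ->]; rewrite inE => /andP[Gx /exists_inP[a Ga]].
  case/exists_inP=> b Gb /eqP xg; apply/subsetP=> _ /imsetP[y Gy ->].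
  rewrite inE groupJ //; apply/exists_inP; exists (y^-1 * a)%g.
    by rewrite groupM ?groupV.
  apply/exists_inP; exists (b * y)%g; first by rewrite groupM.
  by rewrite lgJ xg !utM !mulmxA.
- move=> _ /sctE[lam Dlam ->]; split; [exact: ch_char | exact: ch_neq0 |].
  suff chC g x : x \in two_sided_class G G G g -> ch lam x = supval G G lam (lg g).
    by move=> _ x y /imsetP[g Gg ->] /chC-> /chC->.
  rewrite inE => /andP[Gx /exists_inP[a Ga /exists_inP[b Gb /eqP xg]]].
  by rewrite chE // xg supval_translate.
(* A representative of each orbit; the default 0 is never reached, since every orbit considered
   contains its [lam]. *)
- pose f (O : {set {ffun V -> F}}) := odflt 0 [pick lam in O].
  have fP lam : lam \in dual frg -> let mu := f (dual_orbit G lam G) in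
      mu \in dual_orbit G lam G /\ mu \in dual frg.
    move=> Dlam; rewrite /f; case: pickP => [mu Omu | /(_ lam)] /=; last first.
      by rewrite dual_orbitE orbit_refl.
    split=> //; case/mem_dual_orbit: Omu => -[a b] /= /andP[Ga Gb] ->.
    by rewrite form_action_dual.
  exists [seq ch (f Om) | Om <- enum [set dual_orbit G lam G | lam in dual frg]].
  split; last by rewrite size_map -cardE card_supercharacters.
    rewrite map_inj_in_uniq ?enum_uniq // => O1 O2; rewrite !mem_enum.
    move=> /imsetP[lam Dlam ->] /imsetP[mu Dmu ->].
    have [Olam Dflam] := fP lam Dlam; have [Omu Dfmu] := fP mu Dmu.
    move/(ch_eq _ _ Dflam Dfmu); move: Olam Omu; rewrite !dual_orbitE.
    move=> /orbit_eqP E1 /orbit_eqP E2 /orbit_eqP E3.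
    exact: etrans (esym E1) (etrans (esym E3) E2).
  move=> chi; split=> [/mapP[O OD ->] | /sctE[lam Dlam ->]].
    move: OD; rewrite mem_enum => /imsetP[lam Dlam ->].
    by have [_ Df] := fP lam Dlam; apply/sctE; exists (f (dual_orbit G lam G)).
  apply/mapP; exists (dual_orbit G lam G); last first.
    by have [/ch_orbit] := fP lam Dlam.
  by rewrite mem_enum; apply/imsetP; exists lam.
move=> i; have [lam Dlam irr_i] := supval_cover i.
exists (ch lam); split=> [|chi [/sctE[mu Dmu ->] irr_mu]].
  by split; [apply/sctE; exists lam | apply: irr_i].
(* Two characters with a common constituent cannot be orthogonal, so the second alternative is
   contradictory. *)
have [/ch_orbit // | /(ch_ortho _ _ Dlam Dmu) lm0] :=
  boolP (mu \in dual_orbit G lam G).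
have := constt_ortho_char (ch_char _ Dlam) (ch_char _ Dmu) (irr_i _ (chE lam)) irr_mu lm0.
by rewrite cfdot_irr eqxx => /eqP; rewrite oner_eq0.
Qed.

End AlgebraGroupTheory.
End Actions.

(** * Block structure of pattern groups *)

Section Supports.
Variables (F : finFieldType) (n : nat).
Implicit Types (Z : rel 'I_n) (x y : 'M[F]_n).

Definition suppmx Z : {set 'M[F]_n} :=
  [set x : 'M[F]_n | [forall i, forall j, (x i j != 0) ==> Z i j]].

Lemma suppmxP Z x :
  reflect (forall i j, ~~ Z i j -> x i j = 0) (x \in suppmx Z).
Proof.
rewrite inE; apply: (iffP 'forall_forallP) => xZ i j.
  by move=> nZ; apply/eqP; apply: contraNT nZ; apply/implyP.
by apply/implyP; apply: contraR => /xZ/eqP.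
Qed.

Lemma suppmx_subspace Z : is_subspace (suppmx Z).
Proof.
move=> c x y /suppmxP x0 /suppmxP y0; apply/suppmxP=> i j nZ.
by rewrite !mxE x0 ?y0 // mulr0 addr0.
Qed.

Lemma suppmx0 Z : 0 \in suppmx Z.
Proof. by apply/suppmxP=> i j _; rewrite mxE. Qed.

Lemma suppmxS Z1 Z2 :
  (forall i j, Z1 i j -> Z2 i j) -> suppmx Z1 \subset suppmx Z2.
Proof.
move=> sZ; apply/subsetP=> x /suppmxP x0; apply/suppmxP=> i j nZ2.
by apply: x0; apply: contra nZ2; apply: sZ.
Qed.

Lemma suppmx_disj Z1 Z2 x : (forall i j, Z1 i j -> ~~ Z2 i j) ->
  x \in suppmx Z1 -> x \in suppmx Z2 -> x = 0.
Proof.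
move=> disj /suppmxP x1 /suppmxP x2; apply/matrixP=> i j; rewrite mxE.
by case: (boolP (Z1 i j)) => [/disj/x2 | /x1].
Qed.

Lemma suppmx_mul Z1 Z2 Z3 x y :
  (forall i l j, Z1 i l -> Z2 l j -> Z3 i j) ->
  x \in suppmx Z1 -> y \in suppmx Z2 -> x *m y \in suppmx Z3.
Proof.
move=> Z12 /suppmxP x0 /suppmxP y0; apply/suppmxP=> i j nZ3.
rewrite mxE big1 // => l _; case: (boolP (Z1 i l)) => [Z1il | /x0->].
  rewrite y0 ?mulr0 //; apply: contra nZ3; exact: Z12 Z1il.
by rewrite mul0r.
Qed.

Lemma suppmx_mul0 Z1 Z2 x y : (forall i l j, Z1 i l -> ~~ Z2 l j) ->
  x \in suppmx Z1 -> y \in suppmx Z2 -> x *m y = 0.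
Proof.
move=> disj x1 y2; have : x *m y \in suppmx (fun _ _ => false).
  apply: suppmx_mul x1 y2 => i l j Z1il Z2lj.
  by rewrite (negPf (disj i l j Z1il)) in Z2lj.
by move/suppmxP=> xy0; apply/matrixP=> i j; rewrite xy0 // mxE.
Qed.

Definition mask Z x : 'M[F]_n := \matrix_(i, j) (x i j *+ Z i j).

Lemma mask_supp Z x : mask Z x \in suppmx Z.
Proof. by apply/suppmxP=> i j /negPf nZ; rewrite mxE nZ. Qed.

Lemma alg_of_supp (A : {set UT F n}) Z :
  (forall i j, Z i j -> (i < j)%N) ->
  (forall g : UT F n, (g \in A) = (lg g \in suppmx Z)) ->
  alg_of A = suppmx Z.
Proof.
move=> Zlt memA; apply/setP=> x; apply/imsetP/idP=> [[g Ag ->] | xZ].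
  by rewrite -memA.
have ux : unitri (1%:M + x).
  have /suppmxP x0 := xZ; apply/unitriP; split=> [i | i j ltji].
    by rewrite !mxE eqxx x0 ?addr0 //; apply/negP=> /Zlt; rewrite ltnn.
  rewrite !mxE -val_eqE /= gtn_eqF // x0 ?addr0 //.
  by apply/negP=> /Zlt; rewrite ltnNge ltnW.
have lgx : lg (MkUT ux) = x by rewrite /lg addrC addKr.
by exists (MkUT ux); rewrite ?memA lgx.
Qed.

Lemma lg_entry (g : UT F n) (i j : 'I_n) : i != j -> lg g i j = utval g i j.
Proof. by move=> nij; rewrite !mxE (negPf nij) subr0. Qed.

Lemma lg_supp_lt (g : UT F n) (i j : 'I_n) : ~~ (i < j)%N -> lg g i j = 0.
Proof.
have [g1 g_lt] := unitriP _ (valP g); rewrite -leqNgt leq_eqVlt.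
case/orP=> [/eqP/val_inj-> | ltji]; first by rewrite !mxE g1 eqxx subrr.
by rewrite lg_entry ?g_lt // -val_eqE /= gtn_eqF.
Qed.

End Supports.

Section PatternBlocks.
Variables (F : finFieldType) (n : nat) (P : pat_order n) (k : nat).
Local Notation gT := (UT F n).
Local Notation V := 'M[F]_n.
Local Notation G := (pattern_group F P).
Local Notation N := (patN_group F P k).
Local Notation Hk := (patHk_group F P k).
Local Notation Hm := (patHm_group F P k).
Local Notation H := (patH_group F P k).

(* The positions at which the algebras g, n, h_k and h_m of [G], [N], [Hk] and
   [Hm] are supported. *)
Definition Zg : rel 'I_n := fun i j => P i j && (i < j)%N.
Definition Zn : rel 'I_n := fun i j => P i j && ((i < k)%N && (k <= j)%N).
Definition Zk : rel 'I_n := fun i j => Zg i j && (j < k)%N.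
Definition Zm : rel 'I_n := fun i j => Zg i j && (k <= i)%N.

Lemma Zn_lt i j : Zn i j -> (i < j)%N.
Proof. by case/and3P=> _ ik kj; apply: leq_trans kj. Qed.

Lemma mem_patG (g : gT) : (g \in G) = (lg g \in suppmx F Zg).
Proof.
rewrite !inE; apply/'forall_forallP/'forall_forallP=> gP i j; apply/implyP.
  apply: contraR; rewrite negb_and => /orP[nP | /lg_supp_lt-> //].
  have nij : i != j by apply: contraNneq nP => ->; apply: pat_refl.
  by rewrite lg_entry //; apply: contraR nP => ?; apply: (implyP (gP i j)).
case: (eqVneq i j) => [-> | nij]; first by rewrite pat_refl.
by rewrite -lg_entry // => gij; have /andP[] := implyP (gP i j) gij.
Qed.

Lemma mem_pat_sub (Z : rel 'I_n) (g : gT) : (forall i j, Z i j -> (i < j)%N) ->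
  (g \in [set g in pattern F P | [forall i, forall j, Z i j ==> (g i j == 0)]])
  = (lg g \in suppmx F (fun i j => Zg i j && ~~ Z i j)).
Proof.
move=> Zlt; rewrite inE -[g \in pattern F P]/(g \in G) mem_patG.
have lgZ i j : Z i j -> lg g i j = utval g i j.
  by move/Zlt=> ltij; rewrite lg_entry // -val_eqE /= ltn_eqF.
apply/andP/suppmxP=> [[/suppmxP gZ /'forall_forallP g0] i j | gZ].
  rewrite negb_and negbK => /orP[/gZ // | Zij].
  by rewrite lgZ //; apply/eqP; apply: (implyP (g0 i j)).
split; first by apply/suppmxP=> i j nZ; rewrite gZ // negb_and nZ.
apply/'forall_forallP=> i j; apply/implyP=> Zij.
by rewrite -lgZ // gZ // negb_and negbK Zij orbT.
Qed.

Lemma eq_suppmx (Z1 Z2 : rel 'I_n) (x : V) :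
  Z1 =2 Z2 -> (x \in suppmx F Z1) = (x \in suppmx F Z2).
Proof.
by move=> eqZ; apply/suppmxP/suppmxP=> x0 i j; move: (x0 i j); rewrite eqZ.
Qed.

Lemma mem_patN (g : gT) : (g \in N) = (lg g \in suppmx F Zn).
Proof.
rewrite [LHS](mem_pat_sub
  (Z := fun i j : 'I_n => (i < j)%N && ((j < k)%N || (k <= i)%N))).
  apply: eq_suppmx => i j; rewrite /Zg /Zn -andbA.
  congr (_ && _); case: ltnP => [ltij | leji] /=.
    by rewrite negb_or -leqNgt -ltnNge andbC.
  by apply/esym/negP=> /andP[ik kj]; have := leq_trans (leq_trans ik kj) leji; rewrite ltnn.
by move=> i j /andP[].
Qed.

Lemma mem_patHk (g : gT) : (g \in Hk) = (lg g \in suppmx F Zk).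
Proof.
rewrite [LHS](mem_pat_sub
  (Z := fun i j : 'I_n => (k <= j)%N && (i < j)%N)).
  apply: eq_suppmx => i j; rewrite /Zk /Zg.
  by case: (i < j)%N; rewrite ?andbF // !andbT -ltnNge.
by move=> i j /andP[].
Qed.

Lemma mem_patHm (g : gT) : (g \in Hm) = (lg g \in suppmx F Zm).
Proof.
rewrite [LHS](mem_pat_sub
  (Z := fun i j : 'I_n => (i < k)%N && (i < j)%N)).
  apply: eq_suppmx => i j; rewrite /Zm /Zg.
  by case: (i < j)%N; rewrite ?andbF // !andbT -leqNgt.
by move=> i j /andP[].
Qed.

Lemma alg_patG : alg_of G = suppmx F Zg.
Proof. by apply: alg_of_supp mem_patG => i j /andP[]. Qed.

Lemma alg_patN : alg_of N = suppmx F Zn.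
Proof. exact: alg_of_supp Zn_lt mem_patN. Qed.

Lemma alg_patHk : alg_of Hk = suppmx F Zk.
Proof. by apply: alg_of_supp mem_patHk => i j /andP[/andP[]]. Qed.

Lemma alg_patHm : alg_of Hm = suppmx F Zm.
Proof. by apply: alg_of_supp mem_patHm => i j /andP[/andP[]]. Qed.

Lemma Zg_trans i l j : Zg i l -> Zg l j -> Zg i j.
Proof.
move=> /andP[Pil il] /andP[Plj lj].
by rewrite /Zg (pat_trans Pil Plj) (ltn_trans il).
Qed.

Lemma ZnE i j : Zn i j = [&& Zg i j, (i < k)%N & (k <= j)%N].
Proof.
rewrite /Zn /Zg -andbA; congr (_ && _); case: (boolP (i < j)%N) => //= nij.
by apply/negP=> /andP[ik kj]; case/negP: nij; apply: leq_trans kj.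
Qed.

Lemma supp_kk x y : x \in suppmx F Zk -> y \in suppmx F Zk -> x *m y \in suppmx F Zk.
Proof.
apply: suppmx_mul => i l j /andP[Zil _] /andP[Zlj jk].
by rewrite /Zk (Zg_trans Zil).
Qed.

Lemma supp_mm x y : x \in suppmx F Zm -> y \in suppmx F Zm -> x *m y \in suppmx F Zm.
Proof.
apply: suppmx_mul => i l j /andP[Zil ki] /andP[Zlj _].
by rewrite /Zm (Zg_trans Zil).
Qed.

Lemma supp_kn x y : x \in suppmx F Zk -> y \in suppmx F Zn -> x *m y \in suppmx F Zn.
Proof.
apply: suppmx_mul => i l j /andP[Zil lk]; rewrite !ZnE => /and3P[Zlj _ ->].
by rewrite (Zg_trans Zil) //= andbT (ltn_trans _ lk) //; case/andP: Zil.
Qed.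

Lemma supp_nm x y : x \in suppmx F Zn -> y \in suppmx F Zm -> x *m y \in suppmx F Zn.
Proof.
apply: suppmx_mul => i l j; rewrite !ZnE => /and3P[Zil -> kl] /andP[Zlj _].
by rewrite (Zg_trans Zil) //= (leq_trans kl) // ltnW //; case/andP: Zlj.
Qed.

(** In each case the columns of the first block and the rows of the second lie on opposite sides of
    the cut at [k]. The products that survive are kk, kn, nm and mm. *)
Lemma supp_mul0 (x y : V) :
  [|| (x \in suppmx F Zk) && (y \in suppmx F Zm),
      (x \in suppmx F Zm) && (y \in suppmx F Zk),
      (x \in suppmx F Zm) && (y \in suppmx F Zn),
      (x \in suppmx F Zn) && (y \in suppmx F Zk) |
      (x \in suppmx F Zn) && (y \in suppmx F Zn)] -> x *m y = 0.
Proof.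
case/or4P=> [| | | /orP[|]] /andP[]; apply: suppmx_mul0 => i l j.
- by case/andP=> _ lk; rewrite /Zm leqNgt lk andbF.
- case/andP=> /andP[_ il] ki; apply/negP=> /andP[/andP[_ lj] jk].
  by have := leq_ltn_trans ki (ltn_trans il (ltn_trans lj jk)); rewrite ltnn.
- case/andP=> /andP[_ il] ki; rewrite ZnE; apply/negP=> /and3P[_ lk _].
  by have := leq_ltn_trans ki (ltn_trans il lk); rewrite ltnn.
- rewrite ZnE => /and3P[_ _ kl]; apply/negP=> /andP[/andP[_ lj] jk].
  by have := leq_ltn_trans kl (ltn_trans lj jk); rewrite ltnn.
by rewrite !ZnE => /and3P[_ _ kl]; rewrite ltnNge kl andbF.
Qed.

Lemma suppS_k : suppmx F Zk \subset suppmx F Zg.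
Proof. by apply: suppmxS => i j /andP[]. Qed.
Lemma suppS_m : suppmx F Zm \subset suppmx F Zg.
Proof. by apply: suppmxS => i j /andP[]. Qed.
Lemma suppS_n : suppmx F Zn \subset suppmx F Zg.
Proof. by apply: suppmxS => i j; rewrite ZnE => /and3P[]. Qed.

Lemma mask_split (x : V) : x \in suppmx F Zg ->
  x = mask Zm x + mask Zn x + mask Zk x.
Proof.
move/suppmxP=> xZ; apply/matrixP=> i j; rewrite !mxE ZnE /Zm /Zk.
case: (boolP (Zg i j)) => [/andP[_ ltij] | /xZ->] /=; last by rewrite !mul0rn !addr0.
case: (ltnP i k) => [ik | ki]; case: (ltnP j k) => [jk | kj]; rewrite /= ?addr0 ?add0r //.
by have := leq_ltn_trans ki (ltn_trans ltij jk); rewrite ltnn.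
Qed.

Lemma mulmx_fixl (g : gT) (x : V) : lg g *m x = 0 -> utval g *m x = x.
Proof. by move=> gx0; rewrite utE mulmxDl mul1mx gx0 addr0. Qed.

Lemma mulmx_fixr (g : gT) (x : V) : x *m lg g = 0 -> x *m utval g = x.
Proof. by move=> gx0; rewrite utE mulmxDr mulmx1 gx0 addr0. Qed.

Lemma suppD Z (x y : V) :
  x \in suppmx F Z -> y \in suppmx F Z -> x + y \in suppmx F Z.
Proof. exact: subspaceD (@suppmx_subspace F n Z) _ _. Qed.

Lemma ut_kn a (x : V) : a \in Hk -> x \in suppmx F Zn -> utval a *m x \in suppmx F Zn.
Proof.
by rewrite mem_patHk => ak xn; rewrite utE mulmxDl mul1mx suppD ?supp_kn.
Qed.

Lemma ut_kk a (x : V) : a \in Hk -> x \in suppmx F Zk -> utval a *m x \in suppmx F Zk.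
Proof.
by rewrite mem_patHk => ak xn; rewrite utE mulmxDl mul1mx suppD ?supp_kk.
Qed.

Lemma ut_mm b (x : V) : b \in Hm -> x \in suppmx F Zm -> utval b *m x \in suppmx F Zm.
Proof.
by rewrite mem_patHm => ak xn; rewrite utE mulmxDl mul1mx suppD ?supp_mm.
Qed.

Lemma ut_nm b (x : V) : b \in Hm -> x \in suppmx F Zn -> x *m utval b \in suppmx F Zn.
Proof.
by rewrite mem_patHm => bm xn; rewrite utE mulmxDr mulmx1 suppD ?supp_nm.
Qed.

(** In the order [Hm], [N], [Hk] every cross product vanishes, so the factors of [g] are read off
    from the three blocks of [lg g]. An order with [z] before [b] or [a] before [z] would create
    terms in n. *)
Lemma lg_tri b z a : b \in Hm -> z \in N -> a \in Hk ->
  lg (b * z * a)%g = lg b + lg z + lg a.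
Proof.
rewrite mem_patHm mem_patN mem_patHk => bm zn ak.
have za : utval z *m lg a = lg a.
  by apply: mulmx_fixl; rewrite supp_mul0 // zn ak !orbT.
have ba : utval b *m lg a = lg a.
  by apply: mulmx_fixl; rewrite supp_mul0 // bm ak !orbT.
have bz : utval b *m lg z = lg z.
  by apply: mulmx_fixl; rewrite supp_mul0 // bm zn !orbT.
rewrite !lgM utM -mulmxA za ba bz.
by rewrite [RHS]addrC [lg b + _]addrC.
Qed.

Lemma patHkm_commute a b : a \in Hk -> b \in Hm -> (a * b = b * a)%g.
Proof.
rewrite mem_patHm mem_patHk => ak bm; apply: lg_inj; rewrite !lgM.
rewrite (mulmx_fixl (g := a)); last by rewrite supp_mul0 // ak bm.
rewrite (mulmx_fixl (g := b)); first exact: addrC.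
by rewrite supp_mul0 // bm ak !orbT.
Qed.

Lemma patHm_cent : Hm \subset 'C(Hk).
Proof. by apply/centsP=> b Hb a Ha; apply/esym/patHkm_commute. Qed.

Lemma patN_sub : N \subset G.
Proof. by apply/subsetP=> g; rewrite mem_patN mem_patG; exact: (subsetP suppS_n). Qed.
Lemma patHk_sub : Hk \subset G.
Proof. by apply/subsetP=> g; rewrite mem_patHk mem_patG; exact: (subsetP suppS_k). Qed.
Lemma patHm_sub : Hm \subset G.
Proof. by apply/subsetP=> g; rewrite mem_patHm mem_patG; exact: (subsetP suppS_m). Qed.

Lemma supp_gn (x y : V) : x \in suppmx F Zg -> y \in suppmx F Zn -> x *m y \in suppmx F Zn.
Proof.
apply: suppmx_mul => i l j Zil; rewrite !ZnE => /and3P[Zlj lk ->].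
by rewrite (Zg_trans Zil) //= andbT (ltn_trans _ lk) //; case/andP: Zil.
Qed.

Lemma supp_ng (x y : V) : x \in suppmx F Zn -> y \in suppmx F Zg -> x *m y \in suppmx F Zn.
Proof.
apply: suppmx_mul => i l j; rewrite !ZnE => /and3P[Zil -> kl] Zlj.
by rewrite (Zg_trans Zil) //= (leq_trans kl) // ltnW //; case/andP: Zlj.
Qed.

Lemma supp_gg (x y : V) : x \in suppmx F Zg -> y \in suppmx F Zg -> x *m y \in suppmx F Zg.
Proof. by apply: suppmx_mul => i l j; apply: Zg_trans. Qed.

Lemma ut_gn g (x : V) : g \in G -> x \in suppmx F Zn -> utval g *m x \in suppmx F Zn.
Proof.
by rewrite mem_patG => gg xn; rewrite utE mulmxDl mul1mx suppD ?supp_gn.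
Qed.

Lemma ut_ng g (x : V) : g \in G -> x \in suppmx F Zn -> x *m utval g \in suppmx F Zn.
Proof.
by rewrite mem_patG => gg xn; rewrite utE mulmxDr mulmx1 suppD ?supp_ng.
Qed.

Lemma patN_norm : G \subset 'N(N).
Proof.
apply/subsetP=> g Gg; rewrite inE; apply/subsetP=> _ /imsetP[z Nz ->].
rewrite mem_patN lgJ ut_ng // ut_gn ?groupV //.
by rewrite -mem_patN.
Qed.

(** Being a left ideal in itself encodes that [G] is an algebra group: its algebra is a subspace
    closed under products. *)
Lemma pattern_left_ideal : left_ideal_subgroup G G.
Proof.
split=> //; first by rewrite alg_patG; apply: suppmx_subspace.
by move=> a x; rewrite alg_patG; apply: supp_gg.
Qed.

(** * Products B N A with B inside [Hm] and A inside [Hk] *)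

Section Triangular.
Variables A B : {group gT}.
Hypotheses (sAk : A \subset Hk) (sBm : B \subset Hm).

Lemma patHk_norm_join : A \subset 'N(B <*> N).
Proof.
rewrite normsY ?(subset_trans sAk) ?(subset_trans patHk_sub patN_norm) //.
apply: cents_norm; rewrite centsC; apply: subset_trans sBm _.
exact: patHm_cent.
Qed.

Lemma joinBN : (B <*> N = B * N)%g.
Proof. by rewrite norm_joinEl // (subset_trans sBm) // (subset_trans patHm_sub patN_norm). Qed.

Lemma triE : (B <*> N <*> A = B * N * A)%g.
Proof. by rewrite (norm_joinEr patHk_norm_join) /= joinBN. Qed.

Lemma triv_BN_k : (B <*> N) :&: Hk = 1%g.
Proof.
apply/trivgP/subsetP=> g /setIP[]; rewrite /= joinBN => /mulsgP[b z Bb Nz ->] ak.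
have bm := subsetP sBm _ Bb; apply/set1P/lg_inj; rewrite lg1.
have := lg_tri bm Nz (group1 _); rewrite mulg1 lg1 addr0 => lgE.
pose Z : rel 'I_n := fun i j => Zm i j || Zn i j.
apply: (@suppmx_disj _ _ Z Zk).
- move=> i j; rewrite /Z ZnE => /orP[/andP[/andP[_ ij] ki] | /and3P[_ _ kj]].
    by rewrite negb_and -leqNgt (leq_trans ki) ?orbT // ltnW.
  by rewrite negb_and -leqNgt kj orbT.
- rewrite lgE suppD //.
    by move: bm; rewrite mem_patHm; apply: subsetP (suppmxS _ _) _ => i j; rewrite /Z => ->.
  by move: Nz; rewrite mem_patN; apply: subsetP (suppmxS _ _) _ => i j; rewrite /Z => ->; rewrite orbT.
by rewrite -mem_patHk.
Qed.

Lemma triv_B_N : B :&: N = 1%g.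
Proof.
apply/trivgP/subsetP=> g /setIP[/(subsetP sBm)]; rewrite mem_patHm mem_patN.
move=> gm gn; apply/set1P/lg_inj; rewrite lg1; apply: suppmx_disj gm gn.
move=> i j /andP[_ ki]; rewrite ZnE; apply/negP=> /and3P[_ ik _].
by have := leq_ltn_trans ki ik; rewrite ltnn.
Qed.

Lemma joinNA : (A <*> N = A * N)%g.
Proof. by rewrite norm_joinEl // (subset_trans sAk) // (subset_trans patHk_sub patN_norm). Qed.

Lemma triv_AN_m : Hm :&: (A <*> N) = 1%g.
Proof.
apply/trivgP/subsetP=> g /setIP[gm]; rewrite /= joinNA => /mulsgP[a z Aa Nz gE].
have ak := subsetP sAk _ Aa; apply/set1P/lg_inj; rewrite lg1.
have lgE : lg g = utval a *m lg z + lg a by rewrite gE lgM.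
pose Z : rel 'I_n := fun i j => Zk i j || Zn i j.
apply: (@suppmx_disj _ _ Z Zm).
- move=> i j; rewrite /Z ZnE => /orP[/andP[/andP[_ ij] jk] | /and3P[_ ik _]].
    by rewrite negb_and -ltnNge (ltn_trans ij) ?orbT.
  by rewrite negb_and -ltnNge ik orbT.
- rewrite lgE addrC suppD //.
    by move: ak; rewrite mem_patHk; apply: subsetP (suppmxS _ _) _ => i j; rewrite /Z => ->.
  have := ut_kn ak; move: Nz; rewrite mem_patN => zn /(_ _ zn).
  by apply: subsetP (suppmxS _ _) _ => i j; rewrite /Z => ->; rewrite orbT.
by rewrite -mem_patHm.
Qed.

Lemma triv_A_N : A :&: N = 1%g.
Proof.
apply/trivgP/subsetP=> g /setIP[/(subsetP sAk)]; rewrite mem_patHk mem_patN.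
move=> gm gn; apply/set1P/lg_inj; rewrite lg1; apply: suppmx_disj gm gn.
move=> i j /andP[_ jk]; rewrite ZnE; apply/negP=> /and3P[_ _ kj].
by have := leq_ltn_trans kj jk; rewrite ltnn.
Qed.

Lemma sum_tri (f : gT -> algC) :
  \sum_(g in B <*> N <*> A) f g
    = \sum_(b in B) \sum_(z in N) \sum_(a in A) f (b * z * a)%g.
Proof.
have := sum_mulg (fun g => \sum_(a in A) f (g * a)%g) (esym joinBN).
rewrite triv_B_N cards1 mul1r => ->.
have := @sum_mulg _ (B <*> N)%G A (B <*> N <*> A)%G f _.
rewrite /= (_ : (B <*> N) :&: A = 1%g) ?cards1 ?mul1r => [-> //|].
  exact: esym (norm_joinEr patHk_norm_join).
by apply/trivgP; rewrite -triv_BN_k setIS.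
Qed.

End Triangular.

Lemma pattern_tri : (Hm <*> N <*> Hk)%G = G.
Proof.
apply/group_inj/eqP; rewrite eqEsubset /= !join_subG patHm_sub patN_sub patHk_sub /=.
apply/subsetP=> g; rewrite mem_patG => /mask_split gE; rewrite triE //.
have /imsetP[b Hb bE] : mask Zm (lg g) \in alg_of Hm by rewrite alg_patHm mask_supp.
have /imsetP[z Nz zE] : mask Zn (lg g) \in alg_of N by rewrite alg_patN mask_supp.
have /imsetP[a Ha aE] : mask Zk (lg g) \in alg_of Hk by rewrite alg_patHk mask_supp.
have -> : g = (b * z * a)%g by apply: lg_inj; rewrite lg_tri // -bE -zE -aE.
by rewrite !mem_mulg.
Qed.

Lemma tri_sub (A B : {group gT}) :
  [/\ B \subset B <*> N <*> A, N \subset B <*> N <*> A & A \subset B <*> N <*> A].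
Proof.
have sX : B <*> N \subset B <*> N <*> A by apply: joing_subl.
by split; rewrite ?joing_subr // (subset_trans _ sX) ?joing_subl ?joing_subr.
Qed.

Lemma patternE : G = (Hm * N * Hk)%g :> {set gT}.
Proof. by rewrite -triE // -[in LHS]pattern_tri. Qed.

Lemma sum_conj_double (A B : {group gT}) (f : gT -> gT -> algC) :
  A \subset Hk -> B \subset Hm ->
  \sum_(y in G) \sum_(p in (Hm <*> N <*> A)%G) \sum_(q in (B <*> N <*> Hk)%G)
     f (p * y^-1)%g (y * q)%g
  = #|N|%:R * #|A|%:R * #|B|%:R * \sum_(g in G) \sum_(h in G) f g h.
Proof.
move=> sAk sBm; pose p_ := (Hm <*> N <*> A)%G; pose q_ := (B <*> N <*> Hk)%G.
rewrite -/p_ -/q_; have [/subsetP smp /subsetP snp _] := tri_sub A Hm.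
have [_ /subsetP snq /subsetP skq] := tri_sub Hk B.
have defG : (Hm * (Hk <*> N))%g = G.
  rewrite patternE joinNA // -mulgA.
  congr (_ * _)%g; apply: normC.
  exact: subset_trans patHk_sub patN_norm.
have := sum_mulg (fun y => \sum_(p in p_) \sum_(q in q_) f (p * y^-1)%g (y * q)%g) defG.
rewrite triv_AN_m // cards1 mul1r => <-.
(* Write y = b a z. As a and b commute, y^-1 = (b z)^-1 a^-1, so [p] absorbs [b * z] and [q] absorbs
   [a * z]. After inverting [a], the arguments are [p * a] and [b * q], and [z] is free, whence the
   factor [#|N|]. *)
transitivity (\sum_(b in Hm) \sum_(a in Hk) \sum_(z in N)
   \sum_(p in p_) \sum_(q in q_) f (p * a)%g (b * q)%g).
  apply: eq_bigr => b Hb.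
  have := sum_mulg (fun w => \sum_(p in p_) \sum_(q in q_)
                       f (p * (b * w)^-1)%g (b * w * q)%g) (esym (joinNA (subxx Hk))).
  rewrite triv_A_N // cards1 mul1r => <-.
  rewrite [RHS](reindex_inj invg_inj) /=.
  apply: eq_big => [a | a Ha]; first by rewrite groupV.
  apply: eq_bigr => z Nz.
  have p_bz : (b * z)%g \in p_ by apply: groupM; [apply: smp | apply: snp].
  have q_az : (a * z)%g \in q_ by apply: groupM; [apply: skq | apply: snq].
  rewrite (reindex_inj (mulIg (b * z)%g)) /=.
  apply: eq_big => [p | p _]; first exact: groupMr.
  rewrite (reindex_inj (mulgI (a * z)^-1%g)) /=.
  apply: eq_big => [q | q _]; first by apply: groupMl; rewrite groupV.
  congr (f _ _); last by rewrite -mulgA mulKVg.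
  have ab : (a^-1 * b^-1 = b^-1 * a^-1)%g by rewrite patHkm_commute ?groupV.
  by rewrite !invMg !mulgA mulgK -!mulgA ab mulKVg.
transitivity (#|N|%:R * \sum_(p in p_) \sum_(a in Hk)
    \sum_(b in Hm) \sum_(q in q_) f (p * a)%g (b * q)%g).
  rewrite [in RHS]exchange_big mulr_sumr /=.
  rewrite [LHS]exchange_big; apply: eq_bigr => a Ha.
  rewrite [in RHS]exchange_big mulr_sumr /=; apply: eq_bigr => b Hb.
  by rewrite sumr_const mulr_natl.
(* The multiplicities: [p * a] hits each element of [G] exactly [#|p_ :&: Hk| = #|A|] times, and
   [b * q] exactly [#|Hm :&: q_| = #|B|] times. *)
have defGp : (p_ * Hk)%g = G.
  rewrite patternE /p_ /= triE // -mulgA; congr (_ * _)%g.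
  by apply/mulSGid.
have defGq : (Hm * q_)%g = G.
  rewrite patternE /q_ /= triE // !mulgA; congr (_ * _ * _)%g.
  by apply/mulGSid.
have capP : p_ :&: Hk = A.
  rewrite /p_ /= (norm_joinEr (patHk_norm_join sAk (subxx Hm))).
  by rewrite setIC -group_modr // setIC /= triv_BN_k // mul1g.
have capQ : Hm :&: q_ = B.
  have NHk : (N * Hk)%g = Hk <*> N.
    by rewrite joinNA // (normC (subset_trans patHk_sub patN_norm)).
  by rewrite /q_ /= triE // -mulgA setIC -group_modl // NHk setIC triv_AN_m // mulg1.
under [X in _ * X]eq_bigr => p _ do
  under eq_bigr => a _ do rewrite (sum_mulg (f (p * a)%g) defGq) capQ.
under [X in _ * X]eq_bigr => p _ do rewrite -mulr_sumr.
rewrite -mulr_sumr (sum_mulg (fun g => \sum_(h in G) f g h) defGp) capP.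
by rewrite -!mulrA; congr (_ * _); apply: mulrCA.
Qed.

Lemma patHkm_TI : Hk :&: Hm = 1%g.
Proof.
apply/trivgP; rewrite /= setIC.
apply: subset_trans (setSI _ (joing_subl Hm N)) _.
by rewrite triv_BN_k.
Qed.

Lemma join_km (A B : {group gT}) :
  A \subset Hk -> B \subset Hm -> A \x B = A <*> B.
Proof.
move=> sA sB; rewrite dprodEY //.
  rewrite (subset_trans sB) // (subset_trans patHm_cent) //.
  exact: centS.
by apply/trivgP; rewrite -patHkm_TI setISS.
Qed.

(** The two sums over [N] are put innermost because they are the ones evaluated first. *)
Lemma sum_tri2 (A B A' B' : {group gT}) (f : gT -> gT -> algC) :
  A \subset Hk -> B \subset Hm -> A' \subset Hk -> B' \subset Hm ->
  \sum_(p in (B <*> N <*> A)%G) \sum_(q in (B' <*> N <*> A')%G) f p q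
  = \sum_(b in B) \sum_(b' in B') \sum_(a in A) \sum_(a' in A')
      \sum_(z in N) \sum_(z' in N) f (b * z * a)%g (b' * z' * a')%g.
Proof.
move=> sA sB sA' sB'; rewrite sum_tri //; apply: eq_bigr => b _.
under eq_bigr => z _ do under eq_bigr => a _ do rewrite sum_tri //.
transitivity (\sum_(z in N) \sum_(b' in B') \sum_(a in A) \sum_(a' in A')
   \sum_(z' in N) f (b * z * a)%g (b' * z' * a')%g).
  apply: eq_bigr => z _; rewrite exchange_big; apply: eq_bigr => b' _.
  by apply: eq_bigr => a _; rewrite exchange_big.
rewrite exchange_big; apply: eq_bigr => b' _.
rewrite exchange_big; apply: eq_bigr => a _.
by rewrite exchange_big.
Qed.

Lemma sum_prod4 (I J : finType) (B B' : {set I}) (A A' : {set J}) c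
    (f : I -> I -> algC) (g : J -> J -> algC) :
  \sum_(b in B) \sum_(b' in B') \sum_(a in A) \sum_(a' in A')
     c * (f b b' * g a a')
  = c * ((\sum_(a in A) \sum_(a' in A') g a a')
         * (\sum_(b in B) \sum_(b' in B') f b b')).
Proof.
set Sg := \sum_(a in A) _; rewrite !mulr_sumr; apply: eq_bigr => b _.
rewrite !mulr_sumr; apply: eq_bigr => b' _.
rewrite [Sg * _]mulrC mulr_sumr mulr_sumr; apply: eq_bigr => a _.
by rewrite !mulr_sumr.
Qed.

Lemma supp_mul3 (t z s t' z' s' : V) :
  t \in suppmx F Zm -> z \in suppmx F Zn -> s \in suppmx F Zk ->
  t' \in suppmx F Zm -> z' \in suppmx F Zn -> s' \in suppmx F Zk ->
  (t + z + s) *m (t' + z' + s') = t *m t' + z *m t' + s *m z' + s *m s'.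
Proof.
move=> tm zn sk t'm z'n s'k; rewrite !mulmxDr !mulmxDl.
rewrite (supp_mul0 (x := s) (y := t')) ?sk ?t'm //.
rewrite (supp_mul0 (x := t) (y := z')) ?tm ?z'n ?orbT //.
rewrite (supp_mul0 (x := z) (y := z')) ?zn ?z'n ?orbT //.
rewrite (supp_mul0 (x := t) (y := s')) ?tm ?s'k ?orbT //.
rewrite (supp_mul0 (x := z) (y := s')) ?zn ?s'k ?orbT //.
by rewrite !add0r addr0.
Qed.

(** * Sums attached to one form [lam], with its one-sided stabilizers on n *)

Variable theta : F -> algC.
Hypothesis theta_neq0 : forall x : F, theta x != 0.
Hypothesis thetaD : forall x y : F, theta (x + y) = theta x * theta y.
Hypothesis theta_neq1 : exists x : F, theta x != 1.
Variable lam : {ffun V -> F}.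
Hypothesis Dlam : lam \in dual (alg_of G).
Variables Kk Km : {group gT}.
Hypothesis memKk : forall a,
  (a \in Kk) = (a \in Hk) && [forall x in alg_of N, lam (lg a *m x) == 0].
Hypothesis memKm : forall b,
  (b \in Km) = (b \in Hm) && [forall x in alg_of N, lam (x *m lg b) == 0].

Let lamD : {in suppmx F Zg &, forall x y, lam (x + y) = lam x + lam y}.
Proof. by rewrite -alg_patG; apply: lin_onD (dual_lin Dlam). Qed.

Let lam_linl (x : V) : (forall y, y \in suppmx F Zn -> x *m y \in suppmx F Zn) ->
  lin_on (alg_of N) (fun y => lam (x *m y)).
Proof.
rewrite alg_patN => xn c y y' ny ny'; rewrite mulmxDr -scalemxAr.
by rewrite (dual_lin Dlam) ?alg_patG ?(subsetP suppS_n) ?xn.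
Qed.

Let lam_linr (x : V) : (forall y, y \in suppmx F Zn -> y *m x \in suppmx F Zn) ->
  lin_on (alg_of N) (fun y => lam (y *m x)).
Proof.
rewrite alg_patN => xn c y y' ny ny'; rewrite mulmxDl -scalemxAl.
by rewrite (dual_lin Dlam) ?alg_patG ?(subsetP suppS_n) ?xn.
Qed.

Lemma sKk : Kk \subset Hk.
Proof. by apply/subsetP=> a; rewrite memKk => /andP[]. Qed.

Lemma sKm : Km \subset Hm.
Proof. by apply/subsetP=> a; rewrite memKm => /andP[]. Qed.

Lemma sum_theta_Nl a : a \in Hk ->
  \sum_(z in N) theta (lam (lg a *m lg z)) = #|N|%:R *+ (a \in Kk).
Proof.
move=> Ha; rewrite -(sum_alg_of N (fun x => theta (lam (lg a *m x)))).
rewrite memKk Ha -card_alg_of.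
apply: (sum_theta_lin theta_neq0 thetaD theta_neq1 _ (alg_of0 N)).
  by rewrite alg_patN; apply: suppmx_subspace.
by apply: lam_linl => y; apply: supp_kn; rewrite -mem_patHk.
Qed.

Lemma sum_theta_Nr b : b \in Hm ->
  \sum_(z in N) theta (lam (lg z *m lg b)) = #|N|%:R *+ (b \in Km).
Proof.
move=> Hb; rewrite -(sum_alg_of N (fun x => theta (lam (x *m lg b)))).
rewrite memKm Hb -card_alg_of.
apply: (sum_theta_lin theta_neq0 thetaD theta_neq1 _ (alg_of0 N)).
  by rewrite alg_patN; apply: suppmx_subspace.
by apply: lam_linr => y yn; apply: supp_nm; rewrite -?mem_patHm.
Qed.

Lemma lam_Kk a (x : V) : a \in Kk -> x \in suppmx F Zn -> lam (utval a *m x) = lam x.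
Proof.
rewrite memKk => /andP[Ha /forall_inP a0] xn.
have axn : lg a *m x \in suppmx F Zn by apply: supp_kn; rewrite -?mem_patHk.
rewrite utE mulmxDl mul1mx lamD ?(subsetP suppS_n) //.
by rewrite (eqP (a0 x _)) ?addr0 ?alg_patN.
Qed.

Lemma lam_Km b (x : V) : b \in Km -> x \in suppmx F Zn -> lam (x *m utval b) = lam x.
Proof.
rewrite memKm => /andP[Hb /forall_inP b0] xn.
have bxn : x *m lg b \in suppmx F Zn by apply: supp_nm; rewrite -?mem_patHm.
rewrite utE mulmxDr mulmx1 lamD ?(subsetP suppS_n) //.
by rewrite (eqP (b0 x _)) ?addr0 ?alg_patN.
Qed.

(** The products of [lg (b * z * a)] and [lg (b' * z' * a')] have two n-terms, one pairing z with b'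
    and one pairing a with z'. Their sums give [#|N|%:R ^+ 2] and force [b'] into [Km] and [a] into
    [Kk]. This makes the characters equal, not merely proportional. *)
Lemma supval_norm_tri :
  supval_norm theta G G lam
  = #|N|%:R ^+ 2 * (supval_norm theta Kk Hk lam * supval_norm theta Hm Km lam).
Proof.
rewrite /supval_norm -{1 2}pattern_tri sum_tri2 //.
transitivity (\sum_(b in Hm) \sum_(b' in Hm) \sum_(a in Hk) \sum_(a' in Hk)
  #|N|%:R ^+ 2 * ((theta (lam (lg b *m lg b')) *+ (b' \in Km))
                  * (theta (lam (lg a *m lg a')) *+ (a \in Kk)))).
  apply: eq_bigr => b Hb; apply: eq_bigr => b' Hb'.
  apply: eq_bigr => a Ha; apply: eq_bigr => a' Ha'.
  transitivity (\sum_(z in N) \sum_(z' in N)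
     theta (lam (lg b *m lg b')) * theta (lam (lg a *m lg a'))
     * (theta (lam (lg z *m lg b')) * theta (lam (lg a *m lg z')))).
    apply: eq_bigr => z Nz; apply: eq_bigr => z' Nz'.
    move: (Hb) (Hb') (Ha) (Ha') (Nz) (Nz').
    rewrite !mem_patHm !mem_patHk !mem_patN => bm b'm ak a'k zn z'n.
    rewrite !lg_tri // supp_mul3 //.
    have := subsetP suppS_m _ (supp_mm bm b'm).
    have := subsetP suppS_k _ (supp_kk ak a'k).
    have := subsetP suppS_n _ (supp_nm zn b'm).
    have := subsetP suppS_n _ (supp_kn ak z'n).
    move=> g1 g2 g3 g4; rewrite !lamD ?suppD // !thetaD; ring.
  under eq_bigr => z _ do rewrite -mulr_sumr -mulr_sumr sum_theta_Nl //.
  rewrite -mulr_sumr -mulr_suml sum_theta_Nr // expr2.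
  case: (b' \in Km); case: (a \in Kk); rewrite ?(mulr0n, mulr1n, mul0r, mulr0) //.
  by rewrite mulrC.
rewrite sum_prod4; congr (_ * (_ * _)).
  rewrite [RHS](eq_bigl (fun a => (a \in Hk) && (a \in Kk))); last first.
    by move=> a; rewrite memKk; case: (a \in Hk).
  rewrite [RHS]big_mkcondr; apply: eq_bigr => a _.
  case: ifP => _; last by rewrite big1.
  by apply: eq_bigr.
apply: eq_bigr => b _.
rewrite [RHS](eq_bigl (fun a => (a \in Hm) && (a \in Km))); last first.
  by move=> a; rewrite memKm; case: (a \in Hm).
by rewrite [RHS]big_mkcondr; apply: eq_bigr => b' _; rewrite mulrb.
Qed.

(** The factors [z1] and [z2] affect only the n-block, where [z1] meets the m-part [t] and [z2]
    meets the k-part [s]. Hence averaging over them tests exactly those two parts. *)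
Lemma tri_mul b1 z1 a1 b2 z2 a2 (t y s : V) :
  b1 \in Hm -> z1 \in N -> a1 \in Hk ->
  t \in suppmx F Zm -> y \in suppmx F Zn -> s \in suppmx F Zk ->
  b2 \in Hm -> z2 \in N -> a2 \in Hk ->
  utval (b1 * z1 * a1)%g *m (t + y + s) *m utval (b2 * z2 * a2)%g
  = utval b1 *m t *m utval b2 + utval a1 *m s *m utval a2
    + (utval a1 *m y *m utval b2 + (lg z1 *m t *m utval b2
       + utval a1 *m s *m lg z2)).
Proof.
move=> Hb1 Nz1 Ha1 tm yn sk Hb2 Nz2 Ha2.
move: (Hb1) (Nz1) (Ha1) (Hb2) (Nz2) (Ha2).
rewrite !mem_patHm !mem_patHk !mem_patN => b1m z1n a1k b2m z2n a2k.
have fixl (g : gT) x : lg g *m x = 0 -> utval g *m x = x := @mulmx_fixl g x.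
have fixr (g : gT) x : x *m lg g = 0 -> x *m utval g = x := @mulmx_fixr g x.
have y'n : utval a1 *m y \in suppmx F Zn := ut_kn Ha1 yn.
have s'k : utval a1 *m s \in suppmx F Zk := ut_kk Ha1 sk.
have wn : lg z1 *m t \in suppmx F Zn by apply: supp_nm.
have t'm : utval b1 *m t \in suppmx F Zm := ut_mm Hb1 tm.
have t1 : utval (b1 * z1 * a1)%g *m t = utval b1 *m t + lg z1 *m t.
  rewrite !utM -!mulmxA (fixl a1 t); last by rewrite supp_mul0 // a1k tm.
  rewrite [utval z1]utE mulmxDl mul1mx mulmxDr.
  by rewrite (fixl b1 (_ *m t)) //; rewrite supp_mul0 // b1m wn !orbT.
have y1 : utval (b1 * z1 * a1)%g *m y = utval a1 *m y.
  rewrite !utM -!mulmxA (fixl z1 (_ *m y)); last by rewrite supp_mul0 // z1n y'n !orbT.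
  by apply: fixl; rewrite supp_mul0 // b1m y'n !orbT.
have s1 : utval (b1 * z1 * a1)%g *m s = utval a1 *m s.
  rewrite !utM -!mulmxA (fixl z1 (_ *m s)); last by rewrite supp_mul0 // z1n s'k !orbT.
  by apply: fixl; rewrite supp_mul0 // b1m s'k !orbT.
have right_m x : x \in suppmx F Zm ->
    x *m utval (b2 * z2 * a2)%g = x *m utval b2.
  move=> xm; have xbm : x *m utval b2 \in suppmx F Zm.
    by rewrite utE mulmxDr mulmx1 suppD // supp_mm.
  rewrite !utM !mulmxA (fixr z2 (_ *m _)); last by rewrite supp_mul0 // xbm z2n !orbT.
  by apply: fixr; rewrite supp_mul0 // xbm a2k !orbT.
have right_n x : x \in suppmx F Zn ->
    x *m utval (b2 * z2 * a2)%g = x *m utval b2.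
  move=> xn; have xbn : x *m utval b2 \in suppmx F Zn by apply: ut_nm.
  rewrite !utM !mulmxA (fixr z2 (_ *m _)); last by rewrite supp_mul0 // xbn z2n !orbT.
  by apply: fixr; rewrite supp_mul0 // xbn a2k !orbT.
have right_k x : x \in suppmx F Zk ->
    x *m utval (b2 * z2 * a2)%g = x *m utval a2 + x *m lg z2.
  move=> xk; have xzn : x *m lg z2 \in suppmx F Zn by apply: supp_kn.
  rewrite !utM !mulmxA (fixr b2 x); last by rewrite supp_mul0 // xk b2m.
  rewrite [utval z2]utE mulmxDr mulmx1 mulmxDl.
  by rewrite (fixr a2 (_ *m lg z2)) //; rewrite supp_mul0 // xzn a2k !orbT.
rewrite 2!mulmxDr t1 y1 s1 3!mulmxDl right_m // right_n // right_n // right_k //.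
rewrite -!addrA; congr (_ + _); rewrite addrCA [RHS]addrCA; congr (_ + _).
by rewrite [RHS]addrCA; congr (_ + _); rewrite addrC.
Qed.

(** The m-block and the k-block supply the two sums defining the little supercharacters. The n-block
    supplies the value at [z] and the two character sums that test membership in [Km] and [Kk]. *)
Lemma sum_tri_lg b z a : b \in Hm -> z \in N -> a \in Hk ->
  \sum_(p in (Hm <*> N <*> Kk)%G) \sum_(q in (Km <*> N <*> Hk)%G)
     theta (lam (utval p *m lg (b * z * a)%g *m utval q))
  = #|N|%:R ^+ 2 * (theta (lam (lg z)) *+ ((a \in Kk) && (b \in Km)))
    * ((\sum_(a1 in Kk) \sum_(a2 in Hk)
          theta (lam (utval a1 *m lg a *m utval a2)))
       * (\sum_(b1 in Hm) \sum_(b2 in Km)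
          theta (lam (utval b1 *m lg b *m utval b2)))).
Proof.
move=> Hb Nz Ha; rewrite sum_tri2 ?sKk ?sKm //.
rewrite -sum_prod4; apply: eq_bigr => b1 Hb1; apply: eq_bigr => b2 Kb2.
apply: eq_bigr => a1 Ka1; apply: eq_bigr => a2 Ha2.
have Hb2 := subsetP sKm _ Kb2; have Ha1 := subsetP sKk _ Ka1.
transitivity (\sum_(z1 in N) \sum_(z2 in N)
   theta (lam (utval b1 *m lg b *m utval b2)) * theta (lam (utval a1 *m lg a *m utval a2))
   * theta (lam (lg z))
   * (theta (lam (lg z1 *m lg b)) * theta (lam (lg a *m lg z2)))).
  apply: eq_bigr => z1 Nz1; apply: eq_bigr => z2 Nz2.
  move: (Hb) (Nz) (Ha) (Nz1) (Nz2).
  rewrite {1}mem_patHm {1}mem_patHk !{1}mem_patN => bm zn ak z1n z2n.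
  rewrite lg_tri // tri_mul //.
  have wn : lg z1 *m lg b \in suppmx F Zn by apply: supp_nm.
  have wn' : lg a *m lg z2 \in suppmx F Zn by apply: supp_kn.
  have wn1 : lg z1 *m lg b *m utval b2 \in suppmx F Zn by apply: ut_nm.
  have wn2 : utval a1 *m lg a *m lg z2 \in suppmx F Zn.
    by rewrite -mulmxA ut_kn.
  have zn1 : utval a1 *m lg z *m utval b2 \in suppmx F Zn.
    by apply: ut_nm => //; apply: ut_kn.
  have tm : utval b1 *m lg b *m utval b2 \in suppmx F Zm.
    have b2m : lg b2 \in suppmx F Zm by rewrite -mem_patHm.
    have b1bm : utval b1 *m lg b \in suppmx F Zm by apply: ut_mm.
    by rewrite [utval b2]utE mulmxDr mulmx1 suppD // supp_mm.
  have sk : utval a1 *m lg a *m utval a2 \in suppmx F Zk.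
    have a2k : lg a2 \in suppmx F Zk by rewrite -mem_patHk.
    have a1ak : utval a1 *m lg a \in suppmx F Zk by apply: ut_kk.
    by rewrite [utval a2]utE mulmxDr mulmx1 suppD // supp_kk.
  have := subsetP suppS_n _ wn1; have := subsetP suppS_n _ wn2.
  have := subsetP suppS_n _ zn1; have := subsetP suppS_m _ tm.
  have := subsetP suppS_k _ sk => g1 g2 g3 g4 g5.
  do 4![rewrite lamD ?suppD //]; rewrite !thetaD.
  (* Since [a1] lies in [Kk] and [b2] in [Km], both are invisible to [lam] on n; so the n-terms no
     longer depend on them. *)
  have -> : lam (utval a1 *m lg z *m utval b2) = lam (lg z).
    by rewrite lam_Km ?lam_Kk //; apply: ut_kn.
  have -> : lam (lg z1 *m lg b *m utval b2) = lam (lg z1 *m lg b) by apply: lam_Km.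
  have -> : lam (utval a1 *m lg a *m lg z2) = lam (lg a *m lg z2).
    by rewrite -mulmxA lam_Kk.
  by rewrite !mulrA.
under eq_bigr => z1 _ do rewrite -mulr_sumr -mulr_sumr sum_theta_Nl //.
rewrite -mulr_sumr -mulr_suml sum_theta_Nr // expr2.
case: (b \in Km); case: (a \in Kk); rewrite ?(mulr0n, mulr1n, mul0r, mulr0) //=.
ring.
Qed.

Lemma patH_E : patH F P k = (Hk * Hm)%g.
Proof. by rewrite /patH cent_joinEr ?patHm_cent. Qed.

Lemma patH_sub : H \subset G.
Proof. by rewrite /= join_subG patHk_sub patHm_sub. Qed.

Lemma patNH1 : N :&: H = 1%g.
Proof.
apply/trivgP/subsetP=> g /setIP[Ng]; rewrite /= patH_E => /mulsgP[a b Ha Hb gE].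
have a1 : a \in (Hm <*> N) :&: Hk.
  apply/setIP; split=> //; rewrite (_ : a = g * b^-1)%g; last by rewrite gE mulgK.
  rewrite /= joinBN // (normC (subset_trans patHm_sub patN_norm)).
  by rewrite mem_mulg ?groupV.
move: a1; rewrite triv_BN_k // => /set1P a1.
have : g \in Hm :&: N by apply/setIP; rewrite gE a1 mul1g in Ng *.
by rewrite triv_B_N.
Qed.

(** * The induced character of the little groups construction *)

Variables (chi_k : 'CF(Kk)) (chi_m : 'CF(Km)) (xi : 'CF(Kk <*> Km)).
Hypothesis chi_kE : {in Kk, forall a, chi_k a = supval theta Kk Hk lam (lg a)}.
Hypothesis chi_mE : {in Km, forall b, chi_m b = supval theta Hm Km lam (lg b)}.
Hypothesis xiE : {in Kk & Km, forall a b, xi (a * b)%g = chi_k a * chi_m b}.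

Lemma joinKkm : Kk <*> Km = (Kk * Km)%g.
Proof. by case/dprodP: (join_km sKk sKm) => _ <-. Qed.

Lemma card_joinKkm : #|Kk <*> Km| = (#|Kk| * #|Km|)%N.
Proof. by rewrite -(dprod_card (join_km sKk sKm)). Qed.

(** Factorization in [Hk] times [Hm] is unique, so [xi] vanishes as soon as one factor leaves its
    subgroup. The order [b * a] is the one met when [b * z * a] is rewritten with its N-part
    first. *)
Lemma xi_val a b : a \in Hk -> b \in Hm ->
  xi (b * a)%g
  = (supval theta Kk Hk lam (lg a) * supval theta Hm Km lam (lg b))
      *+ ((a \in Kk) && (b \in Km)).
Proof.
move=> Ha Hb; rewrite -patHkm_commute //.
have [/andP[Ka Kb] | nK] := boolP (_ && _); first by rewrite xiE // chi_kE // chi_mE.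
rewrite cfun0 //=; apply: contra nK; rewrite joinKkm => /mulsgP[a' b' Ka' Kb' E].
have : (a'^-1 * a)%g \in (Hm <*> N) :&: Hk.
  apply/setIP; split; last by rewrite groupM // groupV (subsetP sKk).
  have -> : (a'^-1 * a = b' * b^-1)%g.
    by apply: (mulgI a'); apply: (mulIg b); rewrite mulKVg -!mulgA mulVg mulg1.
  apply: (subsetP (joing_subl _ _)).
  by rewrite groupM ?groupV // (subsetP sKm).
rewrite triv_BN_k // => /set1P/(canRL (mulKVg _)); rewrite mulg1 => aE.
by move: E; rewrite aE => /mulgI->; rewrite Ka'.
Qed.

Variable i : Iirr N.
Hypothesis chi_iE : {in N, forall z, 'chi_i z = theta (lam (lg z))}.
Hypothesis sKI : Kk <*> Km \subset 'I_H['chi_i].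
Local Notation I := ('I_H['chi_i])%G.

(* The extension by zero to [G] of the function [z h |-> psi z * xi h]. *)
Let D (g : gT) : algC := \sum_(z in N) 'chi_i z * xi (z^-1 * g)%g.

Lemma semidirect_sum (L : {group gT}) (eta : 'CF(L)) z h : L \subset H ->
  z \in N -> h \in H ->
  \sum_(y in N) 'chi_i y * eta (y^-1 * (z * h))%g = 'chi_i z * eta h.
Proof.
move=> sLH Nz Hh; rewrite (bigD1 z) //= mulKg big1 ?addr0 // => y /andP[Ny yz].
rewrite [eta _]cfun0 ?mulr0 //; apply: contra yz => /(subsetP sLH).
rewrite mulgA groupMr // => yzH.
have : (y^-1 * z)%g \in N :&: H by rewrite inE yzH groupM ?groupV.
by rewrite patNH1 => /set1P/(canRL (mulKVg _)); rewrite mulg1 => ->.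
Qed.

(** Convolution over [N] expresses the extension by zero by one formula, with no choice of factors;
    only the N-component of [g] contributes, because [N] and [H] meet trivially. *)
Lemma rtimes_support (L : {group gT}) (eta : 'CF(L)) (vtheta : 'CF(N <*> L)) :
  L \subset H ->
  {in N & L, forall x y, vtheta (x * y)%g = 'chi_i x * eta y} ->
  forall g, vtheta g = \sum_(z in N) 'chi_i z * eta (z^-1 * g)%g.
Proof.
move=> sLH vE g; have NL x : (x \in N <*> L) = (x \in N * L)%g.
  rewrite norm_joinEr //.
  exact: subset_trans sLH (subset_trans patH_sub patN_norm).
have [|ngNL] := boolP (g \in N <*> L).
  rewrite NL => /mulsgP[z h Nz Lh ->]; rewrite vE //.
  by rewrite semidirect_sum // (subsetP sLH).
rewrite cfun0 //= big1 // => z Nz; rewrite [eta _]cfun0 ?mulr0 //.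
apply: contra ngNL => Lzg; rewrite /= NL; apply/mulsgP.
by exists z (z^-1 * g)%g; rewrite ?mulKVg.
Qed.

(** Both inductions collapse into one average over [G]: psi is invariant under its inertia group
    [I], so ['Ind[I]] commutes with forming the product with psi. The factors [#|I|] cancel, leaving
    only the orders of [N], [Kk] and [Km]. *)
Lemma rtimes_ind (phi : 'CF(G)) :
  is_rtimes 'chi_i ('Ind[I, Kk <*> Km] xi) phi ->
  forall g, phi g = (#|N|%:R * #|Kk|%:R * #|Km|%:R)^-1 * \sum_(y in G) D (g ^ y)%g.
Proof.
case=> vtheta vE -> g.
have sIH : I \subset H by apply: subsetIl.
have sNIG : N <*> I \subset G.
  by rewrite join_subG patN_sub (subset_trans sIH) ?patH_sub.
rewrite cfIndE //.
have cardNI : #|N <*> I| = (#|N| * #|I|)%N.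
  rewrite norm_joinEr ?(subset_trans sIH) ?(subset_trans patH_sub) ?patN_norm //.
  rewrite TI_cardMg //; apply/trivgP.
  by rewrite -patNH1 setIS.
have vthetaE y : vtheta (g ^ y)%g
    = (#|Kk|%:R * #|Km|%:R)^-1 * \sum_(w in I) D (g ^ (y * w))%g.
  rewrite (rtimes_support sIH vE) mulr_sumr.
  under eq_bigr => z _ do rewrite cfIndE // card_joinKkm natrM mulrCA mulr_sumr mulr_sumr.
  rewrite exchange_big; apply: eq_bigr => w Iw; rewrite -mulr_sumr; congr (_ * _).
  rewrite /D [RHS](reindex_inj (conjg_inj w)) /=.
  have [Hw Iw'] := setIP Iw; have Nw := subsetP (subset_trans patH_sub patN_norm) _ Hw.
  apply: eq_big => [z | z Nz]; first by rewrite memJ_norm.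
  have E : ((z^-1 * g ^ y) ^ w = (z ^ w)^-1 * g ^ (y * w))%g.
    by rewrite conjMg conjVg conjgM.
  by rewrite E inertia_valJ.
rewrite (eq_bigr _ (fun y _ => vthetaE y)) -mulr_sumr exchange_big /=.
(* The conjugation by [w] is absorbed by the sum over all of [G]. *)
have sum_w w : w \in I -> \sum_(y in G) D (g ^ (y * w))%g = \sum_(y in G) D (g ^ y)%g.
  move=> Iw; have Gw := subsetP (subset_trans sIH patH_sub) _ Iw.
  rewrite [RHS](reindex_inj (mulIg w)) /=.
  by apply: eq_bigl => y; rewrite groupMr.
rewrite (eq_bigr _ sum_w) sumr_const cardNI natrM -[_ *+ #|I|]mulr_natl.
have [nzN nzI] : #|N|%:R != 0 :> algC /\ #|I|%:R != 0 :> algC.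
  by rewrite !pnatr_eq0 -!lt0n !cardG_gt0.
have [nzKk nzKm] : #|Kk|%:R != 0 :> algC /\ #|Km|%:R != 0 :> algC.
  by rewrite !pnatr_eq0 -!lt0n !cardG_gt0.
by field; rewrite nzN nzI nzKk nzKm.
Qed.

Lemma D_val g : g \in G ->
  D g = (supval_norm theta G G lam)^-1
    * \sum_(p in (Hm <*> N <*> Kk)%G) \sum_(q in (Km <*> N <*> Hk)%G)
        theta (lam (utval p *m lg g *m utval q)).
Proof.
rewrite patternE => /mulsgP[_ a /mulsgP[b z Hb Nz ->] Ha ->].
rewrite sum_tri_lg // supval_norm_tri.
(* [D] reads the N-part on the left, while the block computation needs [b * z * a]; moving [b]
   across replaces [z] by a conjugate. *)
have defg : (b * z * a)%g = (z ^ b^-1 * (b * a))%g.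
  by rewrite conjgE invgK !mulgA mulgKV.
have Nzb : (z ^ b^-1)%g \in N.
  by rewrite memJ_norm // (subsetP patN_norm) // groupV (subsetP patHm_sub).
rewrite {1}defg /D semidirect_sum //; last 2 first.
- exact: subset_trans sKI (subsetIl _ _).
- by rewrite /= patH_E -patHkm_commute // mem_mulg.
rewrite xi_val //; case: andP => [[Ka Kb] | _]; last first.
  by rewrite !mulr0n !mulr0 mul0r mulr0.
(* Left multiplication by [b] is trivial on n, and right multiplication by an element of [Km] is
   invisible to [lam] there. *)
have -> : 'chi_i (z ^ b^-1)%g = theta (lam (lg z)).
  rewrite chi_iE // lgJ invgK; have zn := Nz; rewrite mem_patN in zn.
  have bm := Hb; rewrite mem_patHm in bm.
  rewrite (mulmx_fixl (g := b)); first by rewrite lam_Km ?groupV.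
  by rewrite supp_mul0 // bm zn !orbT.
rewrite !mulr1n /supval.
have nzN : #|N|%:R != 0 :> algC by rewrite pnatr_eq0 -lt0n cardG_gt0.
rewrite !invfM; set a1 := _^-1; set a2 := _^-1.
set S1 := \sum_(_ in Kk) _; set S2 := \sum_(_ in Hm) _.
by field.
Qed.

Lemma rtimes_supval (phi : 'CF(G)) :
  is_rtimes 'chi_i ('Ind[I, Kk <*> Km] xi) phi ->
  {in G, forall g, phi g = supval theta G G lam (lg g)}.
Proof.
move=> /rtimes_ind phiE g Gg; rewrite phiE.
under eq_bigr => y Gy do rewrite D_val ?groupJ //.
rewrite -mulr_sumr mulrCA /supval; congr (_ * _).
(* Conjugating [g] by [y] moves [y] onto both multipliers, giving [p * y^-1] and [y * q]; the factor
   produced is exactly the denominator in [rtimes_ind]. *)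
have := sum_conj_double (fun u v => theta (lam (utval u *m lg g *m utval v))) sKk sKm.
under eq_bigr => y _ do under eq_bigr => p _ do under eq_bigr => q _ do
  rewrite !utM mulmxA -(mulmxA (utval p)) -(mulmxA (utval p)) -lgJ.
move=> ->; rewrite mulKf // !mulf_neq0 // pnatr_eq0 -lt0n cardG_gt0 //.
Qed.

Lemma lg_N_add x y : x \in N -> y \in N -> lg (x * y)%g = lg x + lg y.
Proof.
rewrite !mem_patN => xn yn; rewrite lgM mulmx_fixl; first exact: addrC.
by rewrite supp_mul0 // xn yn !orbT.
Qed.

Lemma patN_abelian : abelian N.
Proof.
by apply/centsP=> x Nx y Ny; apply: lg_inj; rewrite !lg_N_add // addrC.
Qed.

(** [is_rtimes] presupposes that z h |-> psi(z) eta(h) is a class function on [N <*> I]. This holds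
    because psi is linear, [N] being abelian, and [I]-invariant. *)
Lemma rtimes_exists (eta : 'CF(I)) :
  exists phi : 'CF(G), is_rtimes 'chi_i eta phi.
Proof.
have sIH : I \subset H by apply: subsetIl.
have nNI : I \subset 'N(N).
  by rewrite (subset_trans sIH) // (subset_trans patH_sub patN_norm).
have memNI x : (x \in N <*> I) = (x \in N * I)%g by rewrite norm_joinEr.
pose f g := \sum_(z in N) 'chi_i z * eta (z^-1 * g)%g.
have fE z h : z \in N -> h \in I -> f (z * h)%g = 'chi_i z * eta h.
  by move=> Nz Ih; rewrite /f semidirect_sum // (subsetP sIH).
have lin_i : 'chi_i \is a linear_char by apply/char_abelianP/patN_abelian.
have [vtheta vE] : exists vtheta : 'CF(N <*> I), {in N <*> I, vtheta =1 f}.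
  apply: cfun_exists => _ _ /[!memNI] /mulsgP[z h Nz Ih ->] /mulsgP[y w Ny Iw ->].
  have [_ Iw'] := setIP Iw; have [_ Ih'] := setIP Ih.
  have nNw := subsetP nNI w Iw; have nNh := subsetP nNI h Ih.
  have Nyh : (y ^ h^-1)%g \in N by rewrite memJ_norm ?groupV.
  (* This isolates the N-part. By invariance under [h], psi takes the same value at [y ^ h^-1] and
     [y], which cancels against its value at [y^-1]. *)
  have -> : ((z * h) ^ (y * w) = (y^-1 * z * y ^ h^-1) ^ w * h ^ w)%g.
    by rewrite conjgM -conjMg; congr (_ ^ w)%g; rewrite !conjgE invgK !mulgA mulgKV.
  have Nz' : (y^-1 * z * y ^ h^-1)%g \in N.
    by apply: groupM => //; apply: groupM => //; rewrite groupV.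
  set u := (y^-1 * z * y ^ h^-1)%g in Nz' *.
  have Nuw : (u ^ w)%g \in N by rewrite memJ_norm.
  have Ihw : (h ^ w)%g \in I by apply: groupJ.
  rewrite (fE _ _ Nuw Ihw) (fE _ _ Nz Ih) (cfunJ eta) // inertia_valJ //.
  congr (_ * _); rewrite /u (lin_charM lin_i) //; last by rewrite groupM ?groupV.
  rewrite (lin_charM lin_i) ?groupV // inertia_valJ ?groupV //.
  by rewrite mulrAC -(lin_charM lin_i) ?groupV // mulVg (lin_char1 lin_i) mul1r.
exists ('Ind[G] vtheta), vtheta => // z h Nz Ih.
by rewrite vE ?fE // memNI mem_mulg.
Qed.

Lemma xi_exists : exists xi' : 'CF(Kk <*> Km),
  {in Kk & Km, forall a b, xi' (a * b)%g = chi_k a * chi_m b}.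
Proof.
exists (cfDprod (join_km sKk sKm) chi_k chi_m) => a b Ka Kb.
by rewrite cfDprodE.
Qed.

End PatternBlocks.

(** * Lattice inertia groups *)

Section LatticeInertia.
Variables (F : finFieldType) (n : nat) (P : pat_order n) (k : nat).
Local Notation gT := (UT F n).
Local Notation V := 'M[F]_n.
Local Notation G := (pattern_group F P).
Local Notation N := (patN_group F P k).
Local Notation Hk := (patHk_group F P k).
Local Notation Hm := (patHm_group F P k).
Local Notation H := (patH_group F P k).
Local Notation Zn := (Zn P k).
Local Notation Zk := (Zk P k).
Local Notation Zm := (Zm P k).
Variable theta : F -> algC.
Hypothesis theta_neq0 : forall x : F, theta x != 0.
Hypothesis thetaD : forall x y : F, theta (x + y) = theta x * theta y.
Hypothesis theta_neq1 : exists x : F, theta x != 1.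

Let N_sub : is_subspace (alg_of N).
Proof. by rewrite alg_patN; apply: suppmx_subspace. Qed.

(** Fourier inversion on n: the coefficients [S nu] of ['chi_i] add up to something nonzero, so some
    [S nu] is nonzero, and translation invariance then identifies ['chi_i] with
    [theta \o nu \o lg]. *)
Lemma irr_patN_form (i : Iirr N) :
  exists2 nu, nu \in dual (alg_of N) &
    {in N, forall z, 'chi_i z = theta (nu (lg z))}.
Proof.
have lin_i : 'chi_i \is a linear_char by apply/char_abelianP/patN_abelian.
pose S (nu : {ffun V -> F}) := \sum_(z in N) 'chi_i z * theta (- nu (lg z)).
have : \sum_(nu in dual (alg_of N)) S nu != 0.
  rewrite exchange_big (bigD1 1%g) //= [X in _ + X]big1 ?addr0.
    rewrite (eq_bigr (fun=> 1)) => [|nu Dnu].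
      by rewrite sumr_const pnatr_eq0 -lt0n; apply/card_gt0P; exists 0; apply: dual0.
    by rewrite (lin_char1 lin_i) mul1r lg1 (lin_on0 (alg_of0 N) (dual_lin Dnu)) oppr0 theta0.
  move=> z /andP[Nz z1]; rewrite -mulr_sumr.
  have Nlz : - lg z \in alg_of N by rewrite (subspaceN N_sub) ?alg_of0 ?mem_alg_of.
  rewrite (eq_bigr (fun nu : {ffun V -> F} => theta (nu (- lg z)))) => [|nu Dnu].
    rewrite (sum_theta_dual theta_neq0 thetaD theta_neq1 N_sub (alg_of0 N)) //.
    rewrite oppr_eq0 -(lg1 F n) (inj_eq (@lg_inj F n)) (negPf z1).
    by rewrite mulr0n mulr0.
  by rewrite (lin_onN (alg_of0 N) (dual_lin Dnu)) ?mem_alg_of.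
case: (boolP [exists nu in dual (alg_of N), S nu != 0]) => [|noE]; last first.
  rewrite big1 ?eqxx // => nu Dnu; move: noE; rewrite negb_exists.
  by move/forallP/(_ nu); rewrite Dnu negbK => /eqP.
case/exists_inP=> nu Dnu nz _; exists nu => // w Nw.
have : 'chi_i w * theta (- nu (lg w)) * S nu = S nu.
  rewrite [in RHS]/S (reindex_inj (mulgI w)) mulr_sumr /=.
  apply: eq_big => [z | z Nz]; first by rewrite groupMl.
  rewrite (lin_charM lin_i) // (lg_N_add Nw Nz).
  rewrite (lin_onD (dual_lin Dnu)) ?mem_alg_of // opprD thetaD; ring.
move/eqP; rewrite -subr_eq0 -{2}[S nu]mul1r -mulrBl mulf_eq0 (negPf nz) orbF.
by rewrite subr_eq0 thetaN // => /eqP/(canRL (divfK (theta_neq0 _))); rewrite mul1r.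
Qed.

(** A constituent of the class function has a form [nu] by [irr_patN_form]; a nonzero inner product
    forces [nu] to equal [l] on n. *)
Lemma form_patN_irr (l : V -> F) : lin_on (alg_of N) l ->
  exists i : Iirr N, {in N, forall z, 'chi_i z = theta (l (lg z))}.
Proof.
move=> lD; have [|phi phiE] := @cfun_exists _ N (fun z => theta (l (lg z))).
  move=> x y Nx Ny; congr (theta (l (lg _))).
  by apply/conjg_fixP/commgP; apply: (centsP (patN_abelian F P k)).
have phi0 : phi != 0.
  apply/eqP=> /cfunP/(_ 1%g)/eqP; rewrite cfunE phiE //.
  by rewrite (negPf (theta_neq0 _)).
have [i] := neq0_has_constt phi0; rewrite irr_consttE cfdotE mulf_eq0 negb_or.
case/andP=> _ nz; have [nu Dnu nuE] := irr_patN_form i; exists i.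
move: nz; rewrite (eq_bigr (fun z => theta (l (lg z) - nu (lg z)))); last first.
  by move=> z Nz; rewrite phiE // nuE // conj_theta // thetaD.
rewrite -(sum_alg_of N (fun x => theta (l x - nu x))).
rewrite (sum_theta_lin theta_neq0 thetaD theta_neq1 N_sub (alg_of0 N)
           (l := fun x => l x - nu x)); last first.
  move=> c x y Nx Ny; rewrite lD // (dual_lin Dnu) //.
  by rewrite opprD addrACA -mulrN -mulrDr.
case: forall_inP => [lnu _ z Nz | _ /eqP//].
by rewrite nuE //; congr theta; apply/esym/eqP; rewrite -subr_eq0 lnu ?mem_alg_of.
Qed.

Section Stabilizers.
Variable l : V -> F.
Hypothesis lD : lin_on (alg_of N) l.

Let l0 : l 0 = 0. Proof. exact (lin_on0 (alg_of0 N) lD). Qed.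

Let lgD : {in suppmx F Zn &, forall x y, l (x + y) = l x + l y}.
Proof. by rewrite -alg_patN; exact (lin_onD lD). Qed.

Let lgZ : {in suppmx F Zn, forall x c, l (c *: x) = c * l x}.
Proof. by rewrite -alg_patN; exact (lin_onZ (alg_of0 N) lD). Qed.

(** The elements of [Hk] whose left multiplication preserves [l] on n. Stated through [lg a], the
    condition is linear, which exhibits the ideal. *)
Definition left_stab : {set gT} :=
  [set a in Hk | [forall x in alg_of N, l (lg a *m x) == 0]].

Definition right_stab : {set gT} :=
  [set b in Hm | [forall x in alg_of N, l (x *m lg b) == 0]].

Lemma left_stabP a :
  reflect (a \in Hk /\ {in suppmx F Zn, forall x, l (lg a *m x) = 0})
          (a \in left_stab).
Proof.
rewrite [a \in left_stab]in_set -(alg_patN F P k); apply: (iffP andP) => -[Ha a0]; split=> //.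
  by move=> x xn; apply/eqP/(forall_inP a0).
by apply/forall_inP=> x xn; apply/eqP/a0.
Qed.

Lemma right_stabP b :
  reflect (b \in Hm /\ {in suppmx F Zn, forall x, l (x *m lg b) = 0})
          (b \in right_stab).
Proof.
rewrite [b \in right_stab]in_set -(alg_patN F P k); apply: (iffP andP) => -[Hb b0]; split=> //.
  by move=> x xn; apply/eqP/(forall_inP b0).
by apply/forall_inP=> x xn; apply/eqP/b0.
Qed.

Lemma left_stab_group_set : group_set left_stab.
Proof.
apply/group_setP; split=> [|a b /left_stabP[Ha a0] /left_stabP[Hb b0]].
  by apply/left_stabP; split=> // x _; rewrite lg1 mul0mx l0.
apply/left_stabP; split=> [|x xn]; first exact: groupM.
have bx : lg b *m x \in suppmx F Zn by apply: supp_kn; rewrite -?mem_patHk.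
have abx := ut_kn Ha bx.
have ax : lg a *m x \in suppmx F Zn by apply: supp_kn; rewrite -?mem_patHk.
rewrite lgM mulmxDl -mulmxA lgD // a0 // addr0 utE mulmxDl mul1mx.
by rewrite lgD ?a0 ?b0 ?addr0 //; apply: supp_kn; rewrite -?mem_patHk.
Qed.
Canonical left_stab_group := Group left_stab_group_set.

Lemma right_stab_group_set : group_set right_stab.
Proof.
apply/group_setP; split=> [|a b /right_stabP[Ha a0] /right_stabP[Hb b0]].
  by apply/right_stabP; split=> // x _; rewrite lg1 mulmx0 l0.
apply/right_stabP; split=> [|x xn]; first exact: groupM.
have xa : x *m lg a \in suppmx F Zn by apply: supp_nm; rewrite -?mem_patHm.
have xb : x *m utval a \in suppmx F Zn by apply: ut_nm.
have xab : x *m utval a *m lg b \in suppmx F Zn.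
  by apply: supp_nm; rewrite -?mem_patHm.
by rewrite lgM mulmxDr mulmxA lgD // a0 // b0 // addr0.
Qed.
Canonical right_stab_group := Group right_stab_group_set.

(** A left stabilizer gives a right ideal: (s a) x = s (a x), and a x stays in n. *)
Lemma left_stab_ideal : right_ideal_subgroup left_stab_group Hk.
Proof.
have memS s : (s \in alg_of left_stab)
    = (s \in suppmx F Zk) && [forall x in suppmx F Zn, l (s *m x) == 0].
  rewrite -alg_patHk -alg_patN; apply/imsetP/andP=> [[a] | [/imsetP[a Ha ->] a0]].
    by rewrite [_ \in left_stab]in_set => /andP[Ha a0] ->; rewrite mem_alg_of.
  by exists a; rewrite // [_ \in left_stab]in_set Ha.
split; first by apply/subsetP=> a /left_stabP[].
  move=> c s t; rewrite /= !memS => /andP[sk /forall_inP s0] /andP[tk /forall_inP t0].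
  rewrite suppmx_subspace //=; apply/forall_inP=> x xn.
  rewrite mulmxDl -scalemxAl lgD ?lgZ ?supp_kn //; last first.
    by rewrite -[_ *: _]addr0 suppmx_subspace ?suppmx0 ?supp_kn.
  by rewrite (eqP (s0 x xn)) (eqP (t0 x xn)) mulr0 addr0.
move=> a s; rewrite alg_patHk /= !memS => ak /andP[sk /forall_inP s0].
rewrite supp_kk //=; apply/forall_inP=> x xn.
by rewrite -mulmxA s0 ?supp_kn.
Qed.

Lemma right_stab_ideal : left_ideal_subgroup right_stab_group Hm.
Proof.
have memS s : (s \in alg_of right_stab)
    = (s \in suppmx F Zm) && [forall x in suppmx F Zn, l (x *m s) == 0].
  rewrite -alg_patHm -alg_patN; apply/imsetP/andP=> [[a] | [/imsetP[a Ha ->] a0]].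
    by rewrite [_ \in right_stab]in_set => /andP[Ha a0] ->; rewrite mem_alg_of.
  by exists a; rewrite // [_ \in right_stab]in_set Ha.
split; first by apply/subsetP=> a /right_stabP[].
  move=> c s t; rewrite /= !memS => /andP[sk /forall_inP s0] /andP[tk /forall_inP t0].
  rewrite suppmx_subspace //=; apply/forall_inP=> x xn.
  rewrite mulmxDr -scalemxAr lgD ?lgZ ?supp_nm //; last first.
    by rewrite -[_ *: _]addr0 suppmx_subspace ?suppmx0 ?supp_nm.
  by rewrite (eqP (s0 x xn)) (eqP (t0 x xn)) mulr0 addr0.
move=> a s; rewrite alg_patHm /= !memS => ak /andP[sk /forall_inP s0].
rewrite supp_mm //=; apply/forall_inP=> x xn.
by rewrite mulmxA s0 ?supp_nm.
Qed.

Variable i : Iirr N.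
Hypothesis chi_iE : {in N, forall z, 'chi_i z = theta (l (lg z))}.

(** Conjugation by [Hk] is one-sided on n, because multiplying n by h_k on the right gives 0. *)
Lemma irr_conj_Hk a z : a \in Hk -> z \in N ->
  'chi_i (z ^ a^-1)%g = theta (l (utval a *m lg z)).
Proof.
move=> Ha Nz; have zn := Nz; rewrite mem_patN in zn.
have nNa : (a^-1)%g \in 'N(N).
  by rewrite groupV (subsetP (subset_trans (patHk_sub F P k) (patN_norm F P k))).
rewrite chi_iE ?memJ_norm // lgJ invgK mulmx_fixr //.
have := groupVr Ha; rewrite mem_patHk => ak.
have azn : utval a *m lg z \in suppmx F Zn := ut_kn Ha zn.
by rewrite (supp_mul0 (P := P) (k := k)) // ak azn !orbT.
Qed.

Lemma irr_conj_Hm b z : b \in Hm -> z \in N ->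
  'chi_i (z ^ b)%g = theta (l (lg z *m utval b)).
Proof.
move=> Hb Nz; have zn := Nz; rewrite mem_patN in zn.
have nNb : b \in 'N(N).
  by rewrite (subsetP (subset_trans (patHm_sub F P k) (patN_norm F P k))).
rewrite chi_iE ?memJ_norm // lgJ mulmx_fixl //.
have := groupVr Hb; rewrite mem_patHm => bm.
by rewrite (supp_mul0 (P := P) (k := k)) // bm zn !orbT.
Qed.

Lemma mem_inertiaP y : y \in 'N(N) ->
  {in N, forall z, 'chi_i (z ^ y)%g = 'chi_i z} -> y \in 'I['chi_i].
Proof.
move=> nNy chiJ; apply/setIdP; split=> //; apply/eqP/cfun_inP=> z Nz.
rewrite cfConjgE // -[in RHS](conjgKV y z) chiJ //.
by rewrite memJ_norm ?groupV.
Qed.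

(** Each factor of a lattice element inside the inertia group stabilizes psi by itself, hence lies
    in the corresponding one-sided stabilizer. These stabilizers form a lattice element inside the
    inertia group, so maximality gives equality. *)
Lemma lattice_inertia_stab (Kk Km : {group gT}) :
  is_lattice_inertia 'chi_i Kk Km -> Kk = left_stab_group /\ Km = right_stab_group.
Proof.
case=> -[idKk idKm] sKI maxK; have [sKk _ _] := idKk; have [sKm _ _] := idKm.
have sKk_S : Kk \subset left_stab.
  apply/subsetP=> a Ka; have Ha := subsetP sKk a Ka.
  have /setIP[_ Ia] := subsetP (subset_trans (joing_subl _ _) sKI) _ (groupVr Ka).
  have ln : lin_on (alg_of N) (fun x => l (lg a *m x)).
    rewrite alg_patN => c x y xn yn; rewrite mulmxDr -scalemxAr -lD ?alg_patN //;
    by apply: supp_kn; rewrite -?mem_patHk.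
  apply/left_stabP; split=> // x; rewrite -alg_patN.
  (* Stabilizing psi only says that [theta] is 1 on the values of x |-> l (lg a *m x); linearity
     over [F] makes these values 0. *)
  apply: (theta_lin_eq1 theta_neq1 N_sub (alg_of0 N) ln) => {}x /imsetP[z Nz ->].
  apply: (mulfI (theta_neq0 (l (lg z)))); rewrite mulr1 -thetaD.
  have zn := Nz; rewrite mem_patN in zn.
  have ak : lg a \in suppmx F Zk by rewrite -mem_patHk.
  have azn : lg a *m lg z \in suppmx F Zn := supp_kn ak zn.
  rewrite -lgD // -[X in X + _]mul1mx -mulmxDl -utE -irr_conj_Hk //.
  by rewrite inertia_valJ // chi_iE.
have sKm_S : Km \subset right_stab.
  apply/subsetP=> b Kb; have Hb := subsetP sKm b Kb.
  have /setIP[_ Ib] := subsetP (subset_trans (joing_subr _ _) sKI) _ Kb.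
  have ln : lin_on (alg_of N) (fun x => l (x *m lg b)).
    rewrite alg_patN => c x y xn yn; rewrite mulmxDl -scalemxAl -lD ?alg_patN //;
    by apply: supp_nm; rewrite -?mem_patHm.
  apply/right_stabP; split=> // x; rewrite -alg_patN.
  apply: (theta_lin_eq1 theta_neq1 N_sub (alg_of0 N) ln) => {}x /imsetP[z Nz ->].
  apply: (mulfI (theta_neq0 (l (lg z)))); rewrite mulr1 -thetaD.
  have zn := Nz; rewrite mem_patN in zn.
  have bm : lg b \in suppmx F Zm by rewrite -mem_patHm.
  have bzn : lg z *m lg b \in suppmx F Zn := supp_nm zn bm.
  rewrite -lgD // -[X in X + _]mulmx1 -mulmxDr -utE -irr_conj_Hm //.
  by rewrite inertia_valJ // chi_iE.
have nN (A : {set gT}) : A \subset G -> A \subset 'N(N).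
  by move=> sAG; exact (subset_trans sAG (patN_norm F P k)).
have sS_H : left_stab \subset Hk by apply/subsetP=> a /left_stabP[].
have sS'_H : right_stab \subset Hm by apply/subsetP=> a /right_stabP[].
have sSI : left_stab_group <*> right_stab_group \subset 'I_H['chi_i].
  rewrite join_subG; apply/andP; split; apply/subsetP=> y Sy; apply/setIP; split.
  - exact: (subsetP (joing_subl Hk Hm)) (subsetP sS_H y Sy).
  - have /left_stabP[Hy y0] := groupVr Sy.
    apply: mem_inertiaP => [|z Nz].
      by rewrite (subsetP (nN _ (patHk_sub F P k))) // (subsetP sS_H).
    rewrite -[y]invgK irr_conj_Hk // chi_iE // utE mulmxDl mul1mx.
    have zn := Nz; rewrite mem_patN in zn.
    by rewrite lgD ?y0 ?addr0 //; apply: supp_kn; rewrite -?mem_patHk.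
  - exact: (subsetP (joing_subr Hk Hm)) (subsetP sS'_H y Sy).
  have /right_stabP[Hy y0] := Sy.
  apply: mem_inertiaP => [|z Nz].
    by rewrite (subsetP (nN _ (patHm_sub F P k))).
  rewrite irr_conj_Hm // chi_iE // utE mulmxDr mulmx1.
  have zn := Nz; rewrite mem_patN in zn.
  by rewrite lgD ?y0 ?addr0 //; apply: supp_nm; rewrite -?mem_patHm.
have eqK : left_stab_group <*> right_stab_group = Kk <*> Km.
  apply: maxK => //; first by split; [apply: left_stab_ideal | apply: right_stab_ideal].
  by rewrite join_subG (subset_trans sKk_S) ?joing_subl ?(subset_trans sKm_S) ?joing_subr.
have [_ joinK _ _] := dprodP (join_km sKk sKm).
(* Maximality compares joins only; the two factors are recovered from the trivial intersection of
   [Hk] and [Hm]. *)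
have TI a b : a \in Hk -> b \in Hm -> a = b -> b = 1%g.
  move=> Ha Hb eab; apply/set1P; rewrite -[[set 1%g]]/(1%g : {set gT}).
  by rewrite -(patHkm_TI F P k) inE -{1}eab Ha.
split; apply/group_inj/eqP; rewrite eqEsubset ?sKk_S ?sKm_S; apply/subsetP=> y Sy.
  have : y \in Kk <*> Km by rewrite -eqK mem_gen // inE Sy.
  rewrite -joinK => /mulsgP[a b Ka Kb yE]; have Hy := subsetP sS_H y Sy.
  rewrite yE (TI (a^-1 * y)%g b) ?mulg1 //; last by rewrite yE mulKg.
    by apply: groupM => //; rewrite groupV; apply: (subsetP sKk).
  exact: (subsetP sKm).
have : y \in Kk <*> Km by rewrite -eqK mem_gen // inE Sy orbT.
rewrite -joinK => /mulsgP[a b Ka Kb yE]; have Hy := subsetP sS'_H y Sy.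
have a1 : a = (y * b^-1)%g by rewrite yE mulgK.
rewrite yE (_ : a = 1%g) ?mul1g // a1 (TI a (y * b^-1)%g) //.
  exact: (subsetP sKk).
by apply: groupM => //; rewrite groupV; apply: (subsetP sKm).
Qed.

End Stabilizers.
End LatticeInertia.

Lemma maskD (F : finFieldType) n (Z : rel 'I_n) c (x y : 'M[F]_n) :
  mask Z (c *: x + y) = c *: mask Z x + mask Z y.
Proof. by apply/matrixP=> i j; rewrite !mxE mulrnDl -mulrnAr. Qed.

Lemma mask_id (F : finFieldType) n (Z : rel 'I_n) (x : 'M[F]_n) :
  x \in suppmx F Z -> mask Z x = x.
Proof.
move/suppmxP=> x0; apply/matrixP=> i j; rewrite mxE.
by case: (boolP (Z i j)) => // /x0->.
Qed.

Lemma mask_disj (F : finFieldType) n (Z1 Z2 : rel 'I_n) (x : 'M[F]_n) :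
  (forall i j, Z1 i j -> ~~ Z2 i j) -> x \in suppmx F Z1 -> mask Z2 x = 0.
Proof.
move=> disj /suppmxP x0; apply/matrixP=> i j; rewrite !mxE.
by case: (boolP (Z1 i j)) => [/disj/negPf-> | /x0->] //; rewrite mul0rn.
Qed.

Lemma supval_congr (F : finFieldType) n (theta : F -> algC)
    (L R : {group UT F n}) (b : {set 'M[F]_n}) (lam mu : {ffun 'M[F]_n -> F}) x :
  {in L & R, forall g h, lg g *m lg h \in b} ->
  {in L & R, forall g h, utval g *m x *m utval h \in b} ->
  {in b, lam =1 mu} -> supval theta L R lam x = supval theta L R mu x.
Proof.
move=> bL bLR eq_b; rewrite /supval /supval_norm; congr (_^-1 * _);
by apply: eq_bigr => g Lg; apply: eq_bigr => h Rh; rewrite eq_b ?bL ?bLR.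
Qed.

Lemma right_supval_congr (F : finFieldType) n (theta : F -> algC)
    (A B : {group UT F n}) (lam mu : {ffun 'M[F]_n -> F}) x :
  right_ideal_subgroup B A -> {in alg_of B, lam =1 mu} -> x \in alg_of B ->
  supval theta B A lam x = supval theta B A mu x.
Proof.
move=> idB eqB Bx; have [sBA sB iB] := idB.
have sAB y : y \in alg_of B -> y \in alg_of A.
  by move=> /imsetP[g Bg ->]; rewrite mem_alg_of (subsetP sBA).
apply: (@supval_congr _ _ theta B A (alg_of B)) => // g h Bg Ah.
  by rewrite iB ?mem_alg_of.
rewrite (right_ideal_stable idB) // utE mulmxDl mul1mx.
by rewrite (subspaceD sB) // iB ?mem_alg_of ?sAB.
Qed.

Lemma left_supval_congr (F : finFieldType) n (theta : F -> algC)
    (A B : {group UT F n}) (lam mu : {ffun 'M[F]_n -> F}) x :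
  left_ideal_subgroup B A -> {in alg_of B, lam =1 mu} -> x \in alg_of B ->
  supval theta A B lam x = supval theta A B mu x.
Proof.
move=> idB eqB Bx; have [sBA sB iB] := idB.
have sAB y : y \in alg_of B -> y \in alg_of A.
  by move=> /imsetP[g Bg ->]; rewrite mem_alg_of (subsetP sBA).
apply: (@supval_congr _ _ theta A B (alg_of B)) => // g h Ag Bh.
  by rewrite iB ?mem_alg_of.
rewrite -mulmxA (left_ideal_stable idB) // utE mulmxDr mulmx1.
by rewrite (subspaceD sB) // iB ?mem_alg_of ?sAB.
Qed.

Lemma ideal_supval_cfun (F : finFieldType) n (theta : F -> algC)
    (L R B : {group UT F n}) (lam : {ffun 'M[F]_n -> F}) :
  B \subset L -> B \subset R ->
  exists chi : 'CF(B), {in B, forall g, chi g = supval theta L R lam (lg g)}.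
Proof.
move=> /subsetP sBL /subsetP sBR; apply: cfun_exists => x y Bx By.
by rewrite lgJ supval_translate ?groupV ?sBL ?sBR.
Qed.

(** * The little groups construction *)

Section LittleGroups.
Variables (F : finFieldType) (n : nat) (P : pat_order n) (k : nat).
Local Notation gT := (UT F n).
Local Notation V := 'M[F]_n.
Local Notation G := (pattern_group F P).
Local Notation N := (patN_group F P k).
Local Notation Hk := (patHk_group F P k).
Local Notation Hm := (patHm_group F P k).
Local Notation H := (patH_group F P k).
Variable theta : F -> algC.
Hypothesis theta_neq0 : forall x : F, theta x != 0.
Hypothesis thetaD : forall x y : F, theta (x + y) = theta x * theta y.
Hypothesis theta_neq1 : exists x : F, theta x != 1.

Lemma dual_G_lin_N lam : lam \in dual (alg_of G) -> lin_on (alg_of N) lam.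
Proof.
move=> Dlam c x y; rewrite alg_patN => xn yn.
by rewrite (dual_lin Dlam) // alg_patG (subsetP (suppS_n F P k)).
Qed.

Variables (i : Iirr N) (Kk Km : {group gT}).
Hypothesis I_L : is_lattice_inertia 'chi_i Kk Km.

Let idKk : right_ideal_subgroup Kk Hk. Proof. by case: I_L => -[]. Qed.
Let idKm : left_ideal_subgroup Km Hm. Proof. by case: I_L => -[]. Qed.

Lemma lattice_inertia_mem lam : lam \in dual (alg_of G) ->
  {in N, forall z, 'chi_i z = theta (lam (lg z))} ->
  (forall a, (a \in Kk) =
     (a \in Hk) && [forall x in alg_of N, lam (lg a *m x) == 0]) /\
  (forall b, (b \in Km) =
     (b \in Hm) && [forall x in alg_of N, lam (x *m lg b) == 0]).
Proof.
move=> Dlam chiE.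
have [-> ->] := lattice_inertia_stab theta_neq0 thetaD theta_neq1
  (dual_G_lin_N Dlam) chiE I_L.
by split=> a; apply: in_set.
Qed.

Lemma little_supval lam (phi : 'CF(G)) (chi_k : 'CF(Kk)) (chi_m : 'CF(Km))
    (xi : 'CF(Kk <*> Km)) :
  lam \in dual (alg_of G) ->
  {in N, forall z, 'chi_i z = theta (lam (lg z))} ->
  {in Kk, forall a, chi_k a = supval theta Kk Hk lam (lg a)} ->
  {in Km, forall b, chi_m b = supval theta Hm Km lam (lg b)} ->
  {in Kk & Km, forall a b, xi (a * b)%g = chi_k a * chi_m b} ->
  is_rtimes 'chi_i ('Ind['I_H['chi_i], Kk <*> Km] xi) phi ->
  {in G, forall g, phi g = supval theta G G lam (lg g)}.
Proof.
move=> Dlam chiE kE mE xiE; have [memKk memKm] := lattice_inertia_mem Dlam chiE.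
have [_ sKI _] := I_L.
exact: (rtimes_supval theta_neq0 thetaD theta_neq1 Dlam memKk memKm kE mE xiE chiE sKI).
Qed.

Let T := dprod_sct (right_ideal_sct theta Hk Kk) (left_ideal_sct theta Hm Km).

Lemma supval_little lam : lam \in dual (alg_of G) ->
  {in N, forall z, 'chi_i z = theta (lam (lg z))} ->
  exists2 chi : 'CF(Kk <*> Km), supercharacter T chi &
    exists2 phi : 'CF(G), is_rtimes 'chi_i ('Ind['I_H['chi_i], Kk <*> Km] chi) phi &
      {in G, forall g, phi g = supval theta G G lam (lg g)}.
Proof.
move=> Dlam chiE; have [memKk memKm] := lattice_inertia_mem Dlam chiE.
have [sKk sbKk _] := idKk; have [sKm sbKm _] := idKm.
have [chi_k kE] := ideal_supval_cfun theta lam (subxx Kk) sKk.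
have [chi_m mE] := ideal_supval_cfun theta lam sKm (subxx Km).
have [xi xiE] := xi_exists memKk memKm chi_k chi_m.
have [phi phiP] := rtimes_exists ('Ind['I_H['chi_i]] xi).
exists xi; last by exists phi => //; exact: (little_supval Dlam chiE kE mE xiE phiP).
have lin_sub (B : {group gT}) : B \subset G -> lin_on (alg_of B) lam.
  move=> sBG c x y /imsetP[g Bg ->] /imsetP[h Bh ->].
  by rewrite (dual_lin Dlam) ?mem_alg_of ?(subsetP sBG).
exists chi_k, chi_m; split=> //.
  apply/(right_supercharacterE theta_neq0 thetaD theta_neq1 _ idKk).
  (* Elements of [dual] vanish outside their subspace, so [lam] is truncated; the supercharacter
     sees only its values on the ideal. *)
  have Dk := dual_restr sbKk (lin_sub _ (subset_trans sKk (patHk_sub F P k))).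
  eexists; first exact: Dk.
  move=> a Ka; rewrite kE //; apply: right_supval_congr idKk _ _.
    by move=> x Kx; rewrite ffunE Kx.
  by rewrite mem_alg_of.
apply/(left_supercharacterE theta_neq0 thetaD theta_neq1 _ idKm).
have Dm := dual_restr sbKm (lin_sub _ (subset_trans sKm (patHm_sub F P k))).
eexists; first exact: Dm.
move=> b Kb; rewrite mE //; apply: left_supval_congr idKm _ _.
  by move=> x Kx; rewrite ffunE Kx.
by rewrite mem_alg_of.
Qed.

Lemma little_supercharacter (chi : 'CF(Kk <*> Km)) (phi : 'CF(G)) :
  supercharacter T chi -> is_rtimes 'chi_i ('Ind['I_H['chi_i], Kk <*> Km] chi) phi ->
  exists2 lam, lam \in dual (alg_of G)
    & {in G, forall g, phi g = supval theta G G lam (lg g)}.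
Proof.
case=> chi_k [chi_m [sck scm chiE]] phiP.
have /(right_supercharacterE theta_neq0 thetaD theta_neq1 _ idKk)[muk Dk kE] := sck.
have /(left_supercharacterE theta_neq0 thetaD theta_neq1 _ idKm)[mum Dm mE] := scm.
have [nu Dn nuE] := irr_patN_form theta_neq0 thetaD theta_neq1 i.
have [sKk sbKk _] := idKk; have [sKm sbKm _] := idKm.
(* [c] is the sum of the algebras of [Kk], [N] and [Km], and [l] glues the three given forms along
   the blocks. A linear extension of [l] to g restricts to each of them, which is all that
   [little_supval] asks of [lam]. *)
pose c := [set x in suppmx F (Zg P) |
  (mask (Zk P k) x \in alg_of Kk) && (mask (Zm P k) x \in alg_of Km)].
pose l (x : V) := muk (mask (Zk P k) x) + nu (mask (Zn P k) x) + mum (mask (Zm P k) x).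
have c_sub : is_subspace c.
  move=> t x y /setIdP[xg /andP[xk xm]] /setIdP[yg /andP[yk ym]]; apply/setIdP.
  by rewrite suppmx_subspace // !maskD sbKk ?sbKm.
have mask0 Z : mask Z (0 : V) = 0.
  by apply/matrixP=> a b; rewrite !mxE mul0rn.
have c0 : 0 \in c by apply/setIdP; rewrite suppmx0 !mask0 !alg_of0.
have lD : lin_on c l.
  move=> t x y /setIdP[xg /andP[xk xm]] /setIdP[yg /andP[yk ym]].
  rewrite /l !maskD (dual_lin Dk) // (dual_lin Dm) // (dual_lin Dn) ?alg_patN ?mask_supp //.
  ring.
have scg : c \subset alg_of G.
  by rewrite alg_patG; apply/subsetP=> x /setIdP[].
have gsub : is_subspace (alg_of G) by rewrite alg_patG; apply: suppmx_subspace.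
have [lam Dlam lamE] :=
  dual_extends theta_neq0 thetaD theta_neq1 gsub (alg_of0 G) scg c_sub c0 lD.
have dkn a b : Zk P k a b -> ~~ Zn P k a b.
  by case/andP=> _ bk; rewrite ZnE [(k <= b)%N]leqNgt bk !andbF.
have dnk a b : Zn P k a b -> ~~ Zk P k a b.
  by rewrite ZnE => /and3P[_ _ kb]; rewrite negb_and -leqNgt kb orbT.
have dmn a b : Zm P k a b -> ~~ Zn P k a b.
  by case/andP=> _ ka; rewrite ZnE ltnNge ka /= andbF.
have dnm a b : Zn P k a b -> ~~ Zm P k a b.
  by rewrite ZnE => /and3P[_ ak _]; rewrite negb_and -ltnNge ak orbT.
have dkm a b : Zk P k a b -> ~~ Zm P k a b.
  case/andP=> /andP[_ ab] bk; rewrite negb_and -ltnNge.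
  by rewrite (ltn_trans ab bk) orbT.
have dmk a b : Zm P k a b -> ~~ Zk P k a b.
  by move=> mab; apply/negP=> /dkm; rewrite mab.
have lam_n : {in alg_of N, lam =1 nu}.
  move=> x; rewrite alg_patN => xn; rewrite lamE.
    rewrite /l (mask_disj dnk xn) (mask_disj dnm xn) (mask_id xn).
    rewrite (lin_on0 (alg_of0 Kk) (dual_lin Dk)) (lin_on0 (alg_of0 Km) (dual_lin Dm)).
    by rewrite addr0 add0r.
  apply/setIdP; rewrite (subsetP (suppS_n F P k)) // (mask_disj dnk xn) (mask_disj dnm xn).
  by rewrite !alg_of0.
have lam_k : {in alg_of Kk, muk =1 lam}.
  move=> x Kx; have xk : x \in suppmx F (Zk P k).
    by case/imsetP: Kx => a Ka ->; rewrite -mem_patHk (subsetP sKk).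
  rewrite lamE.
    rewrite /l (mask_disj dkn xk) (mask_disj dkm xk) (mask_id xk).
    rewrite (lin_on0 (alg_of0 N) (dual_lin Dn)) (lin_on0 (alg_of0 Km) (dual_lin Dm)).
    by rewrite !addr0.
  apply/setIdP; rewrite (subsetP (suppS_k F P k)) // (mask_id xk) (mask_disj dkm xk).
  by rewrite Kx alg_of0.
have lam_m : {in alg_of Km, mum =1 lam}.
  move=> x Kx; have xm : x \in suppmx F (Zm P k).
    by case/imsetP: Kx => a Ka ->; rewrite -mem_patHm (subsetP sKm).
  rewrite lamE.
    rewrite /l (mask_disj dmn xm) (mask_disj dmk xm) (mask_id xm).
    rewrite (lin_on0 (alg_of0 N) (dual_lin Dn)) (lin_on0 (alg_of0 Kk) (dual_lin Dk)).
    by rewrite !add0r.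
  apply/setIdP; rewrite (subsetP (suppS_m F P k)) // (mask_id xm) (mask_disj dmk xm).
  by rewrite Kx alg_of0.
exists lam => //; apply: (little_supval Dlam _ _ _ chiE phiP).
- by move=> z Nz; rewrite nuE // lam_n ?mem_alg_of.
- by move=> a Ka; rewrite kE // (right_supval_congr theta idKk lam_k) ?mem_alg_of.
by move=> b Kb; rewrite mE // (left_supval_congr theta idKm lam_m) ?mem_alg_of.
Qed.

End LittleGroups.

Theorem theorem5p6
  (F : finFieldType) (theta : F -> algC)
  (theta_neq0 : forall x : F, theta x != 0)
  (thetaD : forall x y : F, theta (x + y) = theta x * theta y)
  (theta_neq1 : exists x : F, theta x != 1)
  (n k m : nat) (n_def : n = (k + m)%N) (P : pat_order n)
  (G := pattern_group F P)
  (N := patN_group F P k)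
  (Hk := patHk_group F P k)
  (Hm := patHm_group F P k)
  (H := patH_group F P k)
  (Kk Km : Iirr N -> {group UT F n})
  (I_L : forall i : Iirr N, is_lattice_inertia 'chi[N]_i (Kk i) (Km i))
  (reps : {set Iirr N}) (reps_G : orbit_reps G reps) :
  exists T : sct_data G,
    (forall phi : 'CF(G),
       supercharacter T phi <->
       little_groups_character H reps
         (fun i : Iirr N =>
            dprod_sct (right_ideal_sct theta Hk (Kk i))
                      (left_ideal_sct theta Hm (Km i)))
         phi) /\
    same_sct T (algebra_group_sct theta G).
Proof.
have idG : left_ideal_subgroup G G := pattern_left_ideal F P.
have sctG := algebra_group_is_sct theta_neq0 thetaD theta_neq1 idG.
(* The supercharacters agree exactly, so the algebra group theory itself is the witness; its
   superclasses then agree trivially. *)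
exists (algebra_group_sct theta G); split; last by split.
have superE chi := left_supercharacterE theta_neq0 thetaD theta_neq1 chi idG.
move=> phi; apply: iff_trans (superE phi) _; split=> [[lam Dlam phiE] | ].
  have [i0 i0E] := form_patN_irr theta_neq0 thetaD theta_neq1 (dual_G_lin_N (k := k) Dlam).
  have [j [[reps_j /cfclassP[y Gy chi_jE]] _]] := reps_G i0.
  (* The restriction of [lam] to n gives a conjugate of the chosen representative. Conjugating [lam]
     by [y] makes it restrict to the representative itself and stays in the same two-sided orbit, so
     the supercharacter is unchanged. *)
  pose lam' := form_action F n lam (y, y).
  have Dlam' : lam' \in dual (alg_of G) by rewrite form_action_dual.
  have nNy : y \in 'N(N) := subsetP (patN_norm F P k) y Gy.
  have jE : {in N, forall z, 'chi_j z = theta (lam' (lg z))}.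
    move=> z Nz; rewrite chi_jE cfConjgE // i0E ?memJ_norm ?groupV //.
    by rewrite lgJ invgK form_actionE.
  have [chi sc_chi [phi' phi'P phi'E]] :=
    supval_little theta_neq0 thetaD theta_neq1 (I_L j) Dlam' jE.
  exists j => //; exists chi => //; suff -> : phi = phi' by [].
  by apply/cfun_inP=> g Gg; rewrite phiE // phi'E // supval_orbit.
case=> i _ [chi sc_chi phiP].
exact (little_supercharacter theta_neq0 thetaD theta_neq1 (I_L i) sc_chi phiP).
Qed.
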